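(* There exist absolute constants $c_1>0$ and $c_2>0$ (not depending on $n$ or on the distribution of $X_n$) such that the following holds. Let $n\in\mathbb{N}$ and let $X_n$ be a random variable only taking values in $\{0,\ldots,n\}$, with expectation $\mu_n=\mathbb{E}X_n$, variance $\sigma_n^2=\operatorname{Var}(X_n)>0$ (where $\sigma_n>0$), fourth cumulant $\kappa_n=\operatorname{Cum}_4(X_n)$, and probability generating function $g_n(z)=\mathbb{E}[z^{X_n}]=\sum_{k=0}^n\mathbb{P}(X_n=k)z^k$, $z\in\mathbb{C}$. (1) If $g_n$ is real rooted, i.e. all complex roots of the polynomial $g_n$ are non-positive real numbers, then $$\sup_{w\in\mathbb{R}}\Big|\mathbb{P}\Big(\frac{X_n-\mu_n}{\sigma_n}\leq w\Big)-F(w)\Big|\leq\frac{c_1}{\sigma_n}.$$ (2) If $g_n$ is cyclotomic, i.e. all complex roots of the polynomial $g_n$ lie on the unit circle $\{z\in\mathbb{C}:|z|=1\}$, then $$\sup_{w\in\mathbb{R}}\Big|\mathbb{P}\Big(\frac{X_n-\mu_n}{\sigma_n}\leq w\Big)-F(w)\Big|\leq c_2\,\frac{|\kappa_n|^{1/4}}{\sigma_n}.$$ Here $F(w)=\frac{1}{\sqrt{2\pi}}\int_{-\infty}^w e^{-x^2/2}\,dx$ is the distribution function of a standard normal random variable.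
   Context: The fourth cumulant of $X_n$ is $\operatorname{Cum}_4(X_n)=\mathbb{E}[(X_n-\mu_n)^4]-3\big(\mathbb{E}[(X_n-\mu_n)^2]\big)^2$, where $\mu_n=\mathbb{E}X_n$. The polynomial $g_n$ has degree less than or equal to $n$; its roots are not assumed to be pairwise distinct. *)

(* Defs.v *)
From HB Require Import structures.
From mathcomp Require Import all_boot all_order all_algebra.
From mathcomp Require Import all_classical all_reals all_analysis.
From mathcomp Require Export complex.

Set Implicit Arguments.
Unset Strict Implicit.
Unset Printing Implicit Defensive.

Import Order.TTheory GRing.Theory Num.Theory.
Import numFieldNormedType.Exports.

Local Open Scope classical_set_scope.
Local Open Scope ring_scope.
Local Open Scope complex_scope.

(* The measure-theoretic expectation and variance are extended reals; [fine]
   loses nothing for the bounded random variables considered here. *)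
Definition mean (R : realType) (d : measure_display) (T : measurableType d)
    (P : probability T R) (X : {RV P >-> R}) : R :=
  fine 'E_P[X].

Definition stddev (R : realType) (d : measure_display) (T : measurableType d)
    (P : probability T R) (X : {RV P >-> R}) : R :=
  Num.sqrt (fine 'V_P[X]).

Definition central_moment (R : realType) (d : measure_display)
    (T : measurableType d) (P : probability T R) (X : {RV P >-> R})
    (k : nat) : R :=
  fine 'E_P[fun t => (X t - mean X) ^+ k].

Definition cumulant4 (R : realType) (d : measure_display)
    (T : measurableType d) (P : probability T R) (X : {RV P >-> R}) : R :=
  central_moment X 4 - 3 * central_moment X 2 ^+ 2.

Definition takes_values_upto (R : realType) (d : measure_display)
    (T : measurableType d) (P : probability T R) (X : {RV P >-> R})
    (n : nat) : Prop :=
  forall t : T, exists2 k : nat, (k <= n)%N & X t = k%:R.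

Definition pgf (R : realType) (d : measure_display) (T : measurableType d)
    (P : probability T R) (X : {RV P >-> R}) (n : nat) : {poly R[i]} :=
  \poly_(k < n.+1) (fine (P [set t | X t = k%:R]))%:C.

Definition real_rooted (R : realType) (p : {poly R[i]}) : Prop :=
  forall z : R[i], root p z -> exists2 x : R, x <= 0 & z = x%:C.

Definition cyclotomic (R : realType) (p : {poly R[i]}) : Prop :=
  forall z : R[i], root p z -> `|z| = 1.

Definition normal_cdf (R : realType) (w : R) : R :=
  (Num.sqrt (2 * pi))^-1 *
  \int[lebesgue_measure]_(x in `]-oo, w]) expR (- x ^+ 2 / 2).

(* The supremum is taken in the extended reals, so that no boundedness
   convention is involved. *)
Definition normal_distance (R : realType) (d : measure_display)
    (T : measurableType d) (P : probability T R) (X : {RV P >-> R}) : \bar R :=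
  ereal_sup (range (fun w : R =>
    `|fine (P [set t | (X t - mean X) / stddev X <= w]) - normal_cdf w|%:E)).

(* Main.v *)
Require Import Defs.
From mathcomp Require Import all_boot all_order all_algebra.
From mathcomp Require Import all_classical all_reals all_analysis.
From mathcomp Require Import measurable_realfun.
From mathcomp Require Import ring lra.

(** Write phi for the characteristic function of (X - mu) / sigma and
    gamma(t) = e^{-t^2/2} for the one of the standard normal law. Both bounds
    come from comparing phi with gamma on a bounded range of frequencies,
    through a smoothing inequality ([smoothing_inequality]): if on ]0, k] both
    functions are at most A / (1 + t^2) and their difference is at most
    B t / (1 + t^2), then the distribution functions differ by O(A / k + B).
    What remains is the choice of k and B in each of the two cases.

    Smoothing. The indicator of ]-oo, w] is replaced by a function of
    k (w - x), up to an affine change: a smoothed sign function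
    ([smooth_sign]) all of whose frequencies lie in [-1, 1], so that by Fubini
    its expectation only involves characteristic functions up to k. Its
    derivative is the Fourier transform of the Bohman window, which is
    nonnegative and decays like y^-4; hence the smoothed sign tends to its
    limit fast enough for the error to be at most C / (|y| + pi)^2
    ([smooth_sign_approx]). Two translates of the Fejer kernel dominate this
    error ([fejer_pair_ge]), and the Fejer kernel has bounded frequencies too:
    the expected error is again an integral of the characteristic function
    over frequencies up to k ([mean_fejer_le]).

    Real roots. The generating function is a product of generating functions
    (1 - p) + p z of Bernoulli laws, so phi is a product of factors that are
    each close to a Gaussian factor, with variances p (1 - p) adding up to
    sigma^2. Telescoping the product ([normc_prod_sub_le]) gives
    |phi - gamma| <= (2 / sigma) t^3 e^{-t^2/4} on ]0, sigma]; take k = sigma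
    and B = O(1 / sigma).

    Roots on the unit circle. The generating function g has real coefficients,
    so g^2 = g * conj g is the product over all roots z of the real polynomials
    (X - z)(X - conj z) / |1 - z|^2 = X + (a / 2)(X - 1)^2 with
    a = 1 / (1 - Re z) >= 1/2. Cumulants are additive over such products, which
    gives 2 sigma^2 = sum a and 2 kappa = sum (a - 3 a^2), hence
    sum a^2 <= 2 |kappa|; moreover phi(t)^2 = prod (1 - a (1 - cos (t / sigma))).
    Put L = |kappa|^{1/4}. For t <= sigma / (2 L) every a (1 - cos (t / sigma))
    is at most 1/2, so phi is real, does not vanish, and is therefore positive;
    comparing the logarithms of phi and gamma yields
    |phi - gamma| <= (|kappa| / 4) (t / sigma)^4 e^{-t^2/4}
    <= (L / (32 sigma)) t e^{-t^2/4}. Take k = sigma / (2 L) and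
    B = O(L / sigma). *)

Set Implicit Arguments.
Unset Strict Implicit.
Unset Printing Implicit Defensive.

Import Order.TTheory GRing.Theory Num.Theory.
Import numFieldNormedType.Exports.
Import ComplexField.Normc.

Local Open Scope classical_set_scope.
Local Open Scope ring_scope.

(** * Elementary bounds for sine, cosine and the exponential *)

Section elementary_bounds.
Context {R : realType}.
Implicit Types x y : R.

Lemma ler_of_derive_ge0 (f f' : R -> R) (a b : R) : a <= b ->
  (forall x, a <= x <= b -> is_derive x 1 f (f' x)) ->
  (forall x, a < x < b -> 0 <= f' x) -> f a <= f b.
Proof.
rewrite le_eqVlt => /predU1P[->//|ab] df f'0.
have [||c] := @MVT R f f' a b ab.
- by move=> x; rewrite in_itv/= => /andP[ax xb]; apply: df; rewrite !ltW.
- apply: derivable_within_continuous => x; rewrite in_itv/= => axb.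
  by case: (df x axb).
- rewrite in_itv/= => /f'0 f'c fE.
  by rewrite -subr_ge0 fE mulr_ge0// subr_ge0 ltW.
Qed.

Lemma ler_of_derive_ge0T (f f' : R -> R) (a b : R) : a <= b ->
  (forall x, is_derive x 1 f (f' x)) ->
  (forall x, a <= x -> 0 <= f' x) -> f a <= f b.
Proof.
move=> ab df f'0; apply: (@ler_of_derive_ge0 f f') => // x /andP[ax _].
by apply: f'0; exact: ltW.
Qed.

Lemma sin_le x : 0 <= x -> sin x <= x.
Proof.
move=> x0.
have := @ler_of_derive_ge0T (fun y => y - sin y) (fun y => 1 - cos y) 0 x x0.
rewrite sin0 subrr subr_ge0; by apply.
Qed.

Lemma cos_ge x : 1 - x ^+ 2 / 2 <= cos x.
Proof.
wlog x0 : x / 0 <= x.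
  move=> H; have [/H//|/ltW x0] := leP 0 x.
  by have := H (- x); rewrite sqrrN cosN oppr_ge0 => /(_ x0).
have := @ler_of_derive_ge0T (fun y => cos y - (1 - y ^+ 2 / 2))
  (fun y => y - sin y) 0 x x0.
rewrite cos0 expr0n/= mul0r subr0 subrr subr_ge0; apply.
- by move=> y; apply: trigger_derive; rewrite /GRing.scale/=; field.
- by move=> y y0; rewrite subr_ge0 sin_le.
Qed.

Lemma sin_ge x : 0 <= x -> x - x ^+ 3 / 6 <= sin x.
Proof.
move=> x0.
have := @ler_of_derive_ge0T (fun y => sin y - (y - y ^+ 3 / 6))
  (fun y => cos y - (1 - y ^+ 2 / 2)) 0 x x0.
rewrite sin0 expr0n/= mul0r subr0 subrr subr_ge0; apply.
- by move=> y; apply: trigger_derive; rewrite /GRing.scale/=; field.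
- by move=> y y0; rewrite subr_ge0 cos_ge.
Qed.

Lemma cos_le x : cos x <= 1 - x ^+ 2 / 2 + x ^+ 4 / 24.
Proof.
wlog x0 : x / 0 <= x.
  move=> H; have [/H//|/ltW x0] := leP 0 x.
  have := H (- x); rewrite sqrrN cosN oppr_ge0 => /(_ x0).
  by have -> : (- x) ^+ 4 = x ^+ 4 by ring.
have := @ler_of_derive_ge0T (fun y => 1 - y ^+ 2 / 2 + y ^+ 4 / 24 - cos y)
  (fun y => sin y - (y - y ^+ 3 / 6)) 0 x x0.
rewrite cos0 !expr0n/= !mul0r subr0 addr0 subrr subr_ge0; apply.
- by move=> y; apply: trigger_derive; rewrite /GRing.scale/=; field.
- by move=> y y0; rewrite subr_ge0 sin_ge.
Qed.

Lemma abs_sin_le x : `|sin x| <= `|x|.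
Proof.
wlog x0 : x / 0 <= x.
  move=> H; have [/H//|/ltW x0] := leP 0 x.
  by have := H (- x); rewrite sinN !normrN oppr_ge0; exact.
have [x1|x1] := leP x 1.
  rewrite !ger0_norm ?sin_le// sin_ge0_pi// x0/=.
  by rewrite (le_trans x1)// (le_trans _ (pi_ge2 R))// ler1n.
by rewrite (le_trans (sin_max x))// ltW// ger0_norm.
Qed.

Lemma abs_sin_sub_le x : `|sin x - x| <= `|x| ^+ 3 / 6.
Proof.
wlog x0 : x / 0 <= x.
  move=> H; have [/H//|/ltW x0] := leP 0 x.
  by have := H (- x); rewrite sinN -opprD !normrN oppr_ge0; exact.
rewrite distrC !ger0_norm// ?subr_ge0 ?sin_le//.
by have := sin_ge x0; lra.
Qed.

Lemma abs_cos_sub_le x : `|cos x - (1 - x ^+ 2 / 2)| <= x ^+ 4 / 24.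
Proof.
rewrite ger0_norm ?subr_ge0 ?cos_ge//.
by have := cos_le x; lra.
Qed.

Lemma one_sub_cos_ge x : `|x| <= 1 -> x ^+ 2 / 4 <= 1 - cos x.
Proof.
move=> x1; have := cos_le x.
have : x ^+ 2 <= 1 by rewrite -(expr1n _ 2) -(real_normK (num_real x)) ler_sqr ?nnegrE.
have -> : x ^+ 4 = (x ^+ 2) ^+ 2 by ring.
by have := sqr_ge0 x; move: (x ^+ 2) => y; nra.
Qed.

Lemma expRN_le x : 0 <= x -> expR (- x) <= 1 - x + x ^+ 2 / 2.
Proof.
move=> x0.
have H z : 0 <= z -> 0 <= expR (- z) - (1 - z).
  by move=> _; rewrite subr_ge0; exact: expR_ge1Dx.
have := @ler_of_derive_ge0T (fun y => 1 - y + y ^+ 2 / 2 - expR (- y))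
  (fun y => expR (- y) - (1 - y)) 0 x x0.
rewrite /= oppr0 expR0 !expr0n/= !mul0r addr0 addr0 subrr subr_ge0; apply; last exact: H.
by move=> y; apply: trigger_derive; rewrite /GRing.scale/=; field.
Qed.

Lemma expR_ge_quadratic x : 0 <= x -> 1 + x + x ^+ 2 / 2 <= expR x.
Proof.
move=> x0.
have := @ler_of_derive_ge0T (fun y => expR y - (1 + y + y ^+ 2 / 2))
  (fun y => expR y - (1 + y)) 0 x x0.
rewrite /= expR0 !expr0n/= !mul0r !addr0 subrr subr_ge0; apply.
- by move=> y; apply: trigger_derive; rewrite /GRing.scale/=; field.
- by move=> y y0; rewrite subr_ge0 expR_ge1Dx.
Qed.

Lemma expRN_le_1B x : 0 <= x <= 2^-1 -> expR (- (x + x ^+ 2)) <= 1 - x.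
Proof.
move=> /andP[x0 x1].
have y0 : 0 <= x + x ^+ 2 by rewrite addr_ge0// sqr_ge0.
rewrite expRN -[leRHS]invrK lef_pV2 ?posrE ?expR_gt0 ?invr_gt0//; last by lra.
apply: le_trans (expR_ge_quadratic y0).
rewrite -[leLHS]mul1r ler_pdivrMr; last lra.
have E : (1 + (x + x ^+ 2) + (x + x ^+ 2) ^+ 2 / 2) * (1 - x) =
  1 + x ^+ 2 / 2 * (1 - x - x ^+ 2 - x ^+ 3) by field.
rewrite E lerDl mulr_ge0 ?divr_ge0 ?sqr_ge0//.
have x2 : x ^+ 2 <= 4^-1 by nra.
have x3 : x ^+ 3 <= 8^-1 by rewrite exprS; have := sqr_ge0 x; nra.
lra.
Qed.

End elementary_bounds.

(** * Integrals over the unit interval and the Fejer kernel *)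

Section unit_interval_integrals.
Context {R : realType}.
Notation mu := (@lebesgue_measure R).
Notation I01 := (`]0, 1]%classic : set R).

Lemma derivable_continuous (f : R -> R) :
  (forall x, derivable f x 1) -> continuous f.
Proof. by move=> df x; apply/differentiable_continuous/derivable1_diffP. Qed.

Lemma integrable_itv01 (f : R -> R) (M : R) : measurable_fun I01 f ->
  (forall t, 0 < t <= 1 -> `|f t| <= M) -> mu.-integrable I01 (EFin \o f).
Proof.
move=> mf fM; apply: measurable_bounded_integrable => //.
  by rewrite /= lebesgue_measure_itv/= lte_fin ltr01 -EFinB ltry.
exists M; split; first exact: num_real.
move=> y My x /=; rewrite in_itv/= => x01; exact: le_trans (fM _ x01) (ltW My).
Qed.

Lemma continuous_integrable_itv01 (f : R -> R) : continuous f ->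
  mu.-integrable I01 (EFin \o f).
Proof.
move=> cf; apply: (@integrableS _ _ _ mu `[0, 1]) => //.
  exact: subset_itv_oc_cc.
apply: continuous_compact_integrable; first exact: segment_compact.
exact: continuous_subspaceT.
Qed.

Lemma measurable_inv_itv01 : measurable_fun I01 (fun t : R => t^-1).
Proof.
have H : measurable_fun (`]0, +oo[%classic : set R) (fun t : R => t^-1).
  apply: open_continuous_measurable_fun; first exact: interval_open.
  move=> t; rewrite inE/= in_itv/= andbT => t0.
  by apply: cvgV; [rewrite gt_eqF|exact: cvg_id].
apply: measurable_funS H => //.
by move=> t /=; rewrite !in_itv/= andbT => /andP[].
Qed.

Lemma Rintegral_itv01_FTC (f F : R -> R) :
  continuous f -> (forall x : R, is_derive x 1 F (f x)) ->
  \int[mu]_(t in I01) f t = F 1 - F 0.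
Proof.
move=> cf dF; rewrite Rintegral_itv_obnd_cbnd; last first.
  exact: continuous_integrable_itv01.
have cF : continuous F by apply: derivable_continuous => x; case: (dF x).
rewrite /Rintegral (@continuous_FTC2 R f F 0 1)//.
- exact: continuous_subspaceT.
- split.
  + by move=> x _; case: (dF x).
  + exact/cvg_at_right_filter/cF.
  + exact/cvg_at_left_filter/cF.
- by move=> x _; rewrite derive1E; case: (dF x).
Qed.

Lemma norm_Rintegral_itv01_le (f g : R -> R) :
  mu.-integrable I01 (EFin \o f) -> mu.-integrable I01 (EFin \o g) ->
  (forall t, 0 < t <= 1 -> `|f t| <= g t) ->
  `|\int[mu]_(t in I01) f t| <= \int[mu]_(t in I01) g t.
Proof.
move=> fi gi fg; apply: (le_trans (le_normr_Rintegral _ fi)); first by [].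
by apply: le_Rintegral => //; exact: integrable_norm.
Qed.

Lemma Rintegral_itv01_cst (c : R) : \int[mu]_(t in I01) c = c.
Proof.
rewrite Rintegral_cst//= lebesgue_measure_itv/= lte_fin ltr01 -EFinB/=.
by rewrite subr0 mulr1.
Qed.

(** The primitive of 1 / (1 + (t T)^2) is atan (t T) / T, and atan is bounded
    by pi / 2 < 2. *)
Lemma Rintegral_itv01_cauchy (T : R) : 0 < T ->
  \int[mu]_(t in I01) (1 + (t * T) ^+ 2)^-1 <= 2 / T.
Proof.
move=> T0; pose f t : R := (1 + (t * T) ^+ 2)^-1.
have cf : continuous f.
  apply: derivable_continuous => x; apply: derivableV; last exact: ex_derive.
  by rewrite gt_eqF// ltr_pwDl// sqr_ge0.
have dF (t : R) : is_derive t 1 (fun t => atan (t * T) / T) (f t).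
  apply: trigger_derive; rewrite /GRing.scale/= /f.
  by rewrite !(mulr0, add0r, addr0, mulr1) mulrCA mulVf ?gt_eqF// mulr1.
rewrite (Rintegral_itv01_FTC cf dF) mul0r atan0 mul0r subr0 mul1r.
rewrite ler_pM2r ?invr_gt0//.
by apply: ltW; apply: lt_trans (atan_ltpi2 _) (pihalf_lt2 _).
Qed.

End unit_interval_integrals.

Section kernels.
Context {R : realType}.
Notation mu := (@lebesgue_measure R).
Notation I01 := (`]0, 1]%classic : set R).

(** Up to scaling, the Fejer kernel, given by its frequencies (1 - |t|)^+. *)
Definition fejer (y : R) : R := \int[mu]_(t in I01) ((1 - t) * cos (t * y)).

Lemma fejerE y : y != 0 -> fejer y = (1 - cos y) / y ^+ 2.
Proof.
move=> y0; rewrite /fejer.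
have cf : continuous (fun t : R => (1 - t) * cos (t * y)).
  by apply: derivable_continuous => t; exact: ex_derive.
have dF (t : R) : is_derive t 1 (fun t =>
    (1 - t) * sin (t * y) * y^-1 - cos (t * y) * (y ^+ 2)^-1)
    ((1 - t) * cos (t * y)).
  by apply: trigger_derive; rewrite /GRing.scale/=; field.
rewrite (Rintegral_itv01_FTC cf dF).
by rewrite !mul0r sin0 cos0 !mul1r subrr; field.
Qed.

(** Stated with a free bound b on |y|, so that y = 0, where the closed form of
    the kernel is meaningless, needs no separate treatment later on. *)
Lemma fejer_ge (y b : R) : `|y| <= b -> 0 < b -> (1 - cos y) / b ^+ 2 <= fejer y.
Proof.
move=> yb b0; have [->|y0] := eqVneq y 0.
  rewrite cos0 subrr mul0r; apply: Rintegral_ge0 => t /=.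
  by rewrite in_itv/= mulr0 cos0 mulr1 subr_ge0 => /andP[].
have y20 : 0 < y ^+ 2 by rewrite exprn_even_gt0.
have b20 : 0 < b ^+ 2 by rewrite exprn_gt0.
rewrite fejerE// ler_wpM2l ?subr_ge0 ?cos_le1// lef_pV2 ?posrE//.
by rewrite -(real_normK (num_real y)) ler_sqr ?nnegrE// ltW.
Qed.

(** 1 - cos y and 1 - cos (y + pi) = 1 + cos y cannot both be small: they add
    up to 2. *)
Lemma fejer_pair_ge (y : R) :
  2 / (`|y| + pi) ^+ 2 <= fejer y + fejer (y + pi).
Proof.
have b0 : 0 < `|y| + pi by rewrite ltr_wpDl// pi_gt0.
have pi0 : 0 <= pi :> R by exact: pi_ge0.
have H1 : `|y| <= `|y| + pi by rewrite lerDl.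
have H2 : `|y + pi| <= `|y| + pi.
  by rewrite (le_trans (ler_normD _ _))// lerD2l ger0_norm.
apply: le_trans (lerD (fejer_ge H1 b0) (fejer_ge H2 b0)).
by rewrite cosDpi -mulrDl opprK addrACA addNr addr0 -mulr2n.
Qed.

End kernels.

(** * A smoothed sign function with bounded frequencies *)

Section bohman_window.
Context {R : realType}.
Notation mu := (@lebesgue_measure R).
Notation I01 := (`]0, 1]%classic : set R).

(** The Bohman window: its Fourier transform is the square of a function, hence
    nonnegative, and decays like y^-4. *)
Definition bohman (t : R) : R := (1 - t) * cos (t * pi) + sin (t * pi) / pi.

Definition bohman_ft (y : R) : R := \int[mu]_(t in I01) (bohman t * cos (t * y)).

(** The primitive of [bohman_ft] that vanishes at 0, with the integration in y
    carried out under the integral sign. *)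
Definition smooth_sign (y : R) : R :=
  \int[mu]_(t in I01) (bohman t * (sin (t * y) / t)).

Let pi_neq0 : pi != 0 :> R. Proof. by rewrite gt_eqF// pi_gt0. Qed.

Lemma derivable_bohman (t : R) : derivable bohman t 1.
Proof. exact: ex_derive. Qed.

Lemma continuous_bohman : continuous bohman.
Proof. exact/derivable_continuous/derivable_bohman. Qed.

Lemma bohman_le2 (t : R) : 0 < t <= 1 -> `|bohman t| <= 2.
Proof.
move=> /andP[t0 t1]; rewrite (le_trans (ler_normD _ _))//.
rewrite (_ : 2 = 1 + 1)// lerD// normrM.
  rewrite -[leRHS]mul1r ler_pM ?cos_max// ger0_norm ?subr_ge0//.
  by rewrite gerBl ltW.
rewrite -[leRHS]mul1r ler_pM ?sin_max// normfV invf_le1 ?normr_gt0//.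
by rewrite (le_trans _ (ler_norm _))// (le_trans _ (pi_ge2 R))// ler1n.
Qed.

(** Since bohman' (t) = - pi (1 - t) sin (pi t), an integration by parts reduces
    the transform to the difference of the Fejer kernel at pi - y and at
    pi + y; the primitive in the proof is what results. *)
Lemma bohman_ftE y : 0 < y -> y != pi ->
  bohman_ft y = 2 * pi ^+ 2 * (1 + cos y) / (pi ^+ 2 - y ^+ 2) ^+ 2.
Proof.
move=> y_gt0 ypi; have y0 : y != 0 by rewrite gt_eqF.
have a0 : pi - y != 0 by rewrite subr_eq0 eq_sym.
have b0 : pi + y != 0 by rewrite gt_eqF// addr_gt0// pi_gt0.
have cf : continuous (fun t : R => bohman t * cos (t * y)).
  by apply: derivable_continuous => t; exact: ex_derive.
have dF (t : R) : is_derive t 1 (fun t =>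
    bohman t * sin (t * y) * y^-1 + pi / (2 * y) *
    ((1 - t) * sin (t * (pi - y)) * (pi - y)^-1
     - cos (t * (pi - y)) * (pi - y)^-1 ^+ 2
     - (1 - t) * sin (t * (pi + y)) * (pi + y)^-1
     + cos (t * (pi + y)) * (pi + y)^-1 ^+ 2))
    (bohman t * cos (t * y)).
  apply: trigger_derive; rewrite /GRing.scale/= /bohman.
  rewrite !(mulrBr t pi y, mulrDr t pi y) !(cosD, sinD, cosN, sinN).
  move: (pi : R) a0 b0 pi_neq0 => p a0 b0 p0.
  by field; rewrite ?a0 ?b0 ?p0 ?y0.
rewrite /bohman_ft (Rintegral_itv01_FTC cf dF) /bohman !mul0r !mul1r.
rewrite !(sin0, cos0, sinpi, cosD, sinD, cospi, cosN, sinN).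
rewrite (_ : pi ^+ 2 - y ^+ 2 = (pi - y) * (pi + y)); last first.
  by move: (pi : R) => p; ring.
move: (pi : R) a0 b0 pi_neq0 => p a0 b0 p0.
by field; rewrite ?a0 ?b0 ?p0 ?y0.
Qed.

Lemma bohman_ft_ge0 y : 0 < y -> y != pi -> 0 <= bohman_ft y.
Proof.
move=> y0 ypi; rewrite bohman_ftE// divr_ge0 ?sqr_ge0//.
have c1 : 0 <= 1 + cos y by have := cos_geN1 y; lra.
by rewrite mulr_ge0// mulr_ge0// sqr_ge0.
Qed.

Lemma bohman_ft_gt0 y : 0 < y < pi -> 0 < bohman_ft y.
Proof.
move=> /andP[y0 ypi]; rewrite bohman_ftE ?lt_eqF//.
have H : 0 < pi ^+ 2 - y ^+ 2 by rewrite subr_gt0 ltr_pXn2r ?nnegrE ?ltW// pi_gt0.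
rewrite divr_gt0 ?exprn_gt0// mulr_gt0// ?mulr_gt0 ?exprn_gt0 ?pi_gt0//.
suff : cos pi < cos y by rewrite cospi; lra.
by rewrite ltr_cos// in_itv/= ?lexx ?pi_ge0// !ltW.
Qed.

Lemma bohman_ft_le y : 2 * pi <= y -> bohman_ft y <= 16 / y ^+ 3.
Proof.
move=> yge; have pi0 := pi_gt0 R; have pi4 := pihalf_lt2 R.
have y0 : 0 < y by apply: lt_le_trans yge; rewrite mulr_gt0.
rewrite bohman_ftE//; last by rewrite gt_eqF//; lra.
rewrite ler_pdivrMr; last by rewrite exprn_even_gt0//= lt_eqF//; nra.
rewrite [leRHS]mulrAC ler_pdivlMr ?exprn_gt0//.
have c1 := cos_le1 y; set c := cos y in c1 *.
have H1 : 3 / 4 * y ^+ 2 <= y ^+ 2 - pi ^+ 2 by nra.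
have H2 : 9 / 16 * y ^+ 4 <= (pi ^+ 2 - y ^+ 2) ^+ 2.
  have -> : 9 / 16 * y ^+ 4 = (3 / 4 * y ^+ 2) ^+ 2 by field.
  rewrite -(sqrrN (pi ^+ 2 - y ^+ 2)) opprB ler_sqr ?nnegrE//.
    by rewrite mulr_ge0// ?sqr_ge0// divr_ge0.
  by apply: le_trans H1; rewrite mulr_ge0// ?sqr_ge0// divr_ge0.
have H3 : pi ^+ 2 <= 2 * y by nra.
have H4 : 2 * pi ^+ 2 * (1 + c) <= 8 * y.
  by have := sqr_ge0 (pi : R); nra.
apply: le_trans (_ : 8 * y * y ^+ 3 <= _).
  by rewrite ler_pM2r ?exprn_gt0.
have y4 : 0 <= y ^+ 4 by rewrite exprn_ge0// ltW.
rewrite -mulrA -exprS; lra.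
Qed.

Lemma measurable_smooth_sign_integrand y :
  measurable_fun I01 (fun t => bohman t * (sin (t * y) / t)).
Proof.
apply: measurable_funM.
  apply: measurable_funTS; apply: continuous_measurable_fun.
  exact: continuous_bohman.
apply: measurable_funM; last exact: measurable_inv_itv01.
apply: measurable_funTS; apply: continuous_measurable_fun.
by apply: derivable_continuous => t; exact: ex_derive.
Qed.

Lemma smooth_sign_integrand_le y t : 0 < t <= 1 ->
  `|bohman t * (sin (t * y) / t)| <= 2 * `|y|.
Proof.
move=> t01; have /andP[t0 _] := t01.
rewrite normrM ler_pM ?bohman_le2// normrM normfV (gtr0_norm t0).
rewrite ler_pdivrMr// (le_trans (abs_sin_le _))// normrM (gtr0_norm t0).
by rewrite mulrC.
Qed.

Lemma integrable_smooth_sign y :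
  mu.-integrable I01 (fun t => (bohman t * (sin (t * y) / t))%:E).
Proof.
apply: integrable_itv01; first exact: measurable_smooth_sign_integrand.
by move=> t t01; exact: smooth_sign_integrand_le.
Qed.

Lemma smooth_sign_le y : `|smooth_sign y| <= 2 * `|y|.
Proof.
rewrite -[leRHS]Rintegral_itv01_cst; apply: norm_Rintegral_itv01_le.
- exact: integrable_smooth_sign.
- by apply: continuous_integrable_itv01 => ?; exact: cvg_cst.
- by move=> t t01; exact: smooth_sign_integrand_le.
Qed.

Lemma smooth_signN y : smooth_sign (- y) = - smooth_sign y.
Proof.
rewrite /smooth_sign -[RHS]mulN1r -RintegralZl//; last exact: integrable_smooth_sign.
by apply: eq_Rintegral => t _; rewrite mulrN sinN !mulNr mulrN mul1r.
Qed.

Lemma smooth_sign0 : smooth_sign 0 = 0.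
Proof. by apply/eqP; rewrite -normr_le0 (le_trans (smooth_sign_le _))// normr0 mulr0. Qed.

(** Differentiation under the integral sign. The frequency t = 0 is left out of the
    interval because 0^-1 = 0 makes sin (t y) / t vanish there for all y, so that
    its derivative in y would not be cos (t y). *)
Lemma is_derive_smooth_sign (y : R) : is_derive y 1 smooth_sign (bohman_ft y).
Proof.
pose f y t := bohman t * (sin (t * y) / t).
have df (x t : R) : t != 0 -> is_derive x 1 (f ^~ t) (bohman t * cos (t * x)).
  move=> t0; rewrite /f.
  by apply: trigger_derive; rewrite /GRing.scale/=; field.
have H := @cvg_differentiation_under_integral R _ _ mu f I01 _ y (y - 1) (y + 1).
have yI : (`](y - 1), (y + 1)[)%classic y.
  by rewrite /= in_itv/=; apply/andP; split; lra.
have dE x t : t != 0 -> partial1of2 f x t = bohman t * cos (t * x).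
  by move=> t0; rewrite partial1of2E; have [] := df x t t0.
have tn0 (t : R) : I01 t -> t != 0.
  by rewrite /= in_itv/= => /andP[t0 _]; rewrite gt_eqF.
have {}H := H _ yI (fun x _ => integrable_smooth_sign x) _ (fun=> 2) _ _ _.
have D : h^-1 *: (smooth_sign (h + y) - smooth_sign y) @[h --> 0^'] --> bohman_ft y.
  rewrite (_ : bohman_ft y = \int[mu]_(t in I01) partial1of2 f y t); last first.
    apply: eq_Rintegral => t; rewrite inE => /tn0 t0.
    by rewrite dE.
  apply: H => //.
  - by apply: continuous_integrable_itv01 => ?; exact: cvg_cst.
  - move=> x t _ tI; rewrite dE ?tn0// normrM -[leRHS]mulr1.
    by rewrite ler_pM// ?cos_max// bohman_le2//; move: tI; rewrite /= in_itv.
apply: DeriveDef.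
  apply/cvg_ex; exists (bohman_ft y); under eq_fun do rewrite scaler1; exact: D.
rewrite -derive1E; apply/cvg_lim => //; exact: D.
Qed.

(** Beyond pi the function increases, as its derivative is nonnegative; beyond
    2 pi adding 8 / y^2 makes it decrease, as its derivative is at most
    16 / y^3. The limit is thus squeezed between the two. It is positive because
    the function starts from 0 with a positive derivative on ]0, pi[. *)
Lemma smooth_sign_limit : exists2 s : R, 0 < s &
  forall y, 2 * pi <= y -> smooth_sign y <= s <= smooth_sign y + 8 / y ^+ 2.
Proof.
have pi0 := pi_gt0 R.
have nd a b : pi <= a -> a <= b -> smooth_sign a <= smooth_sign b.
  move=> pia ab; apply: (ler_of_derive_ge0 ab).
    by move=> x _; exact: is_derive_smooth_sign.
  move=> x /andP[ax _]; apply: bohman_ft_ge0; first by lra.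
  by rewrite gt_eqF//; lra.
have tail a b : 2 * pi <= a -> a <= b ->
    smooth_sign b + 8 / b ^+ 2 <= smooth_sign a + 8 / a ^+ 2.
  move=> pia ab; rewrite -lerN2.
  pose g x := - (smooth_sign x + 8 * (x ^+ 2)^-1).
  pose g' x := 16 / x ^+ 3 - bohman_ft x.
  have dg x : a <= x <= b -> is_derive x 1 g (g' x).
    move=> /andP[ax _]; have x0 : x ^+ 2 != 0 by rewrite gt_eqF// exprn_gt0//; lra.
    have dV : is_derive x 1 (fun x : R => (x ^+ 2)^-1) (- (x ^+ 2) ^- 2 *: (2 * x)).
      apply: is_deriveV => //.
      by apply: trigger_derive; rewrite /GRing.scale/=; ring.
    have dS := is_derive_smooth_sign x.
    apply: trigger_derive; rewrite /GRing.scale/= /g'.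
    by field; apply/eqP => xE; move: x0; rewrite xE expr0n/= eqxx.
  apply: (ler_of_derive_ge0 ab dg) => x /andP[ax _].
  by rewrite subr_ge0; apply: bohman_ft_le; lra.
pose E := smooth_sign @` `[2 * pi, +oo[.
have E0 : E !=set0 by exists (smooth_sign (2 * pi)); exists (2 * pi) => //=; rewrite in_itv/= lexx.
have bound y : 2 * pi <= y -> ubound E (smooth_sign y + 8 / y ^+ 2).
  move=> piy _ [z + <-]; rewrite /= in_itv/= andbT => piz.
  have [zy|yz] := leP z y.
    apply: le_trans (nd _ _ _ zy) _; first by lra.
    by rewrite lerDl divr_ge0// sqr_ge0.
  apply: le_trans (tail _ _ piy (ltW yz)).
  by rewrite lerDl divr_ge0// sqr_ge0.
have ubE : has_ubound E by exists (smooth_sign (2 * pi) + 8 / (2 * pi) ^+ 2); exact: bound.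
have le_s y : 2 * pi <= y -> smooth_sign y <= sup E.
  by move=> piy; apply: ub_le_sup => //; exists y => //=; rewrite in_itv/= piy.
exists (sup E).
  apply: lt_le_trans (le_s (2 * pi) (lexx _)).
  apply: lt_le_trans (nd pi _ (lexx _) _); last by lra.
  have [||c] := @MVT R smooth_sign bohman_ft 0 pi pi0.
  - by move=> x _; exact: is_derive_smooth_sign.
  - apply: continuous_subspaceT; apply: derivable_continuous => x.
    by case: (is_derive_smooth_sign x).
  - rewrite in_itv/= => c0pi; rewrite smooth_sign0 !subr0 => ->.
    by rewrite mulr_gt0// bohman_ft_gt0.
move=> y piy; rewrite le_s//=; apply: ge_sup => //; exact: bound.
Qed.

Lemma smooth_sign_approx : exists s C : R, [/\ 0 < s, 0 < C & forall y,
  `|smooth_sign y - (if 0 <= y then s else - s)| <= C / (`|y| + pi) ^+ 2].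
Proof.
have [s s0 sE] := smooth_sign_limit.
have pi0 := pi_gt0 R; have pi4 := pihalf_lt2 R.
(* The constant 18 serves |y| >= 2 pi, where |y| + pi <= 3 |y| / 2 turns 8 / y^2
   into 18 / (|y| + pi)^2. The other one serves |y| < 2 pi, where |y| + pi is
   below 12 and |smooth_sign y| <= 2 |y| below 16. *)
exists s, ((16 + s) * 144 + 18); split=> //; first by lra.
have pos y : 0 <= y ->
    `|smooth_sign y - s| <= ((16 + s) * 144 + 18) / (`|y| + pi) ^+ 2.
  move=> y0; have p0 : 0 < y + pi by lra.
  rewrite (ger0_norm y0) ler_pdivlMr ?exprn_gt0//.
  have [y2pi|y2pi] := leP (2 * pi) y.
    have ygt0 : 0 < y by lra.
    have /andP[h1 h2] := sE _ y2pi.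
    rewrite ler0_norm ?subr_le0// opprB.
    apply: le_trans (_ : 8 / y ^+ 2 * (y + pi) ^+ 2 <= _).
      by rewrite ler_pM2r ?exprn_gt0// lerBlDl.
    rewrite mulrAC ler_pdivrMr ?exprn_gt0//.
    apply: le_trans (_ : 18 * y ^+ 2 <= _).
      by nra.
    by rewrite ler_pM2r ?exprn_gt0//; lra.
  have h1 : `|smooth_sign y - s| <= 16 + s.
    rewrite (le_trans (ler_normB _ _))// (gtr0_norm s0) lerD2r.
    by rewrite (le_trans (smooth_sign_le _))// ger0_norm//; lra.
  have h2 : (y + pi) ^+ 2 <= 144 by nra.
  apply: le_trans (ler_pM _ _ h1 h2) _ => //; first exact: sqr_ge0.
  by lra.
move=> y; have [y0|y0] := leP 0 y; first exact: pos.
have := pos (- y); rewrite smooth_signN normrN oppr_ge0 => /(_ (ltW y0)).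
by rewrite -opprD normrN opprK.
Qed.

End bohman_window.

(** * Sine and cosine transforms of a random variable *)

Section characteristic_function.
Context {R : realType} d (T : measurableType d) (P : probability T R).
Notation mu := (@lebesgue_measure R).
Notation I01 := (`]0, 1]%classic : set R).
Implicit Types (Y Z : T -> R) (a : R -> R).

(** Real and imaginary parts of the characteristic function of Y. *)
Definition cos_transform Y (t : R) : R := \int[P]_x cos (t * Y x).
Definition sin_transform Y (t : R) : R := \int[P]_x sin (t * Y x).

Lemma bounded_integrable_prob (f : T -> R) (M : R) : measurable_fun setT f ->
  (forall x, `|f x| <= M) -> P.-integrable setT (EFin \o f).
Proof.
move=> mf fM; apply: measurable_bounded_integrable => //.
  exact: le_lt_trans (probability_le1 P measurableT) (ltry 1).
exists M; split; first exact: num_real.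
by move=> y My x _; exact: le_trans (fM _) (ltW My).
Qed.

Lemma measurable_cos_comp Z : measurable_fun setT Z ->
  measurable_fun setT (fun x => cos (Z x)).
Proof.
move=> mZ; apply: measurableT_comp => //.
by apply: continuous_measurable_fun; exact: continuous_cos.
Qed.

Lemma measurable_sin_comp Z : measurable_fun setT Z ->
  measurable_fun setT (fun x => sin (Z x)).
Proof.
move=> mZ; apply: measurableT_comp => //.
by apply: continuous_measurable_fun; exact: continuous_sin.
Qed.

Lemma integrable_cos Z : measurable_fun setT Z ->
  P.-integrable setT (EFin \o (fun x => cos (Z x))).
Proof.
move=> mZ; apply: (@bounded_integrable_prob _ 1); first exact: measurable_cos_comp.
by move=> x; exact: cos_max.
Qed.

Lemma integrable_sin Z : measurable_fun setT Z ->
  P.-integrable setT (EFin \o (fun x => sin (Z x))).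
Proof.
move=> mZ; apply: (@bounded_integrable_prob _ 1); first exact: measurable_sin_comp.
by move=> x; exact: sin_max.
Qed.

(** The phase b gives the sine transform as well, at b = pi / 2. *)
Lemma continuous_cos_transform Z (b : R) : measurable_fun setT Z ->
  continuous (fun t : R => \int[P]_x cos (t * Z x - b)).
Proof.
move=> mZ t.
have mf (u : R) : measurable_fun setT (fun x => u * Z x - b).
  by apply: measurable_funB => //; apply: measurable_funM.
have := @continuity_under_integral R _ T P (fun (t : R) (x : T) => cos (t * Z x - b)) setT
  measurableT (t - 1) (t + 1) _ _ (fun=> 1) _ _.
apply => //.
- by move=> u _; exact: integrable_cos.
- apply/aeW => x _ u _.
  apply: (@derivable_continuous R (fun t : R => cos (t * Z x - b))) => v.
  exact: ex_derive.
- by apply: (@bounded_integrable_prob _ 1) => // x; rewrite normr1.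
- by move=> u _; apply/aeW => x _; exact: cos_max.
- by rewrite inE/= in_itv/=; apply/andP; split; lra.
Qed.

Section fubini.
Variables (a : R -> R) (Z : T -> R) (b : R) (G : T -> R).
Hypotheses (ma : measurable_fun I01 a) (mZ : measurable_fun setT Z).
Hypothesis iG : P.-integrable setT (EFin \o G).
Hypothesis fG : forall x t, 0 < t <= 1 -> `|a t * cos (t * Z x - b)| <= G x.

(** The weight is extended by 0 outside of ]0, 1], as Fubini applies to integrals
    over the whole product space. *)
Let F (z : T * R) : \bar R := ((a \_ I01) z.2 * cos (z.2 * Z z.1 - b))%:E.

Let mF : measurable_fun setT F.
Proof.
apply/measurable_EFinP; apply: measurable_funM.
  apply: measurableT_comp => //.
  by apply/(measurable_restrict _ _ measurableT) => //; rewrite setTI.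
apply: (measurableT_comp (f := @cos R)).
  by apply: continuous_measurable_fun; exact: continuous_cos.
apply: measurable_funB => //; apply: measurable_funM => //.
exact: measurableT_comp.
Qed.

Let FE x : (\int[mu]_t F (x, t) = \int[mu]_(t in I01) (a t * cos (t * Z x - b))%:E)%E.
Proof.
rewrite [RHS]integral_mkcond; apply: eq_integral => t _.
rewrite /F /= !patchE; case: ifP => // _; by rewrite mul0r.
Qed.

Let normFE x : (\int[mu]_t `|F (x, t)| =
  \int[mu]_(t in I01) (`|a t * cos (t * Z x - b)|)%:E)%E.
Proof.
rewrite [RHS]integral_mkcond; apply: eq_integral => t _.
by rewrite /F /= !patchE; case: ifP => // _; rewrite mul0r normr0.
Qed.

Let ms x : measurable_fun I01 (fun t => a t * cos (t * Z x - b)).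
Proof.
apply: measurable_funM => //; apply: measurable_funTS.
apply: continuous_measurable_fun; apply: derivable_continuous => v.
exact: ex_derive.
Qed.

Let isec x : mu.-integrable I01 (EFin \o (fun t => a t * cos (t * Z x - b))).
Proof. by apply: (@integrable_itv01 _ _ (G x)) => // t; exact: fG. Qed.

Let iF : (P \x mu)%E.-integrable setT F.
Proof.
apply/integrable12ltyP => //.
have /integrableP[mG] := iG; apply: le_lt_trans.
apply: ge0_le_integral => //.
- by move=> x _; apply: integral_ge0.
- apply: (measurable_fun_fubini_tonelli_F (m2 := mu) (fun z => `|F z|)%E) => //.
  exact: measurableT_comp.
- exact: measurableT_comp.
move=> x _; rewrite normFE.
apply: le_trans (_ : \int[mu]_(t in I01) (G x)%:E <= _)%E.
  apply: ge0_le_integral => //.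
  - by apply/measurable_EFinP; apply: measurableT_comp => //; exact: ms.
  - by move=> t /= t01; rewrite lee_fin fG//; move: t01; rewrite in_itv.
rewrite integral_cst//= lebesgue_measure_itv/= lte_fin ltr01 -EFinB subr0 mule1.
by rewrite lee_fin ler_norm.
Qed.

Lemma integrable_Fubini_cos :
  P.-integrable setT
    (EFin \o (fun x => \int[mu]_(t in I01) (a t * cos (t * Z x - b)))).
Proof.
have := integrable_fubini_F iF; apply: eq_integrable => // x _.
by rewrite /fubini_F /= FE /Rintegral fineK//; exact: (integrable_fin_num _ (isec x)).
Qed.

Lemma Fubini_cos :
  \int[P]_x \int[mu]_(t in I01) (a t * cos (t * Z x - b)) =
  \int[mu]_(t in I01) (a t * \int[P]_x cos (t * Z x - b)).
Proof.
rewrite /Rintegral; congr fine.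
transitivity (\int[P]_x \int[mu]_t F (x, t))%E.
  apply: eq_integral => x _; by rewrite FE fineK//; exact: (integrable_fin_num _ (isec x)).
rewrite Fubini// [RHS]integral_mkcond; apply: eq_integral => t _.
rewrite /F patchE /=; case: ifP => tI; last first.
  by rewrite patchE tI; under eq_integral do rewrite mul0r; rewrite integral0.
rewrite patchE tI.
have mt : measurable_fun setT (fun x => t * Z x - b).
  by apply: measurable_funB => //; apply: measurable_funM.
under eq_integral do rewrite EFinM.
rewrite integralZl//; last exact: integrable_cos.
by rewrite EFinM fineK//; apply: integrable_fin_num => //; exact: integrable_cos.
Qed.

End fubini.

Lemma cos_transform_affine Y (c k b t : R) : measurable_fun setT Y ->
  \int[P]_x cos (t * (c - k * Y x) - b) =
  cos (t * c - b) * cos_transform Y (t * k) +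
  sin (t * c - b) * sin_transform Y (t * k).
Proof.
move=> mY.
have mt : measurable_fun setT (fun x => t * k * Y x) by apply: measurable_funM.
have ic := integrable_cos mt; have iS := integrable_sin mt.
rewrite /cos_transform /sin_transform -!RintegralZl// -RintegralD//; last 2 first.
- by have := integrableZl measurableT (cos (t * c - b)) ic.
- by have := integrableZl measurableT (sin (t * c - b)) iS.
apply: eq_Rintegral => x _.
rewrite (_ : t * (c - k * Y x) - b = (t * c - b) - t * k * Y x); last by ring.
by rewrite cosB.
Qed.

Section smoothing.
Variables (Y : T -> R) (k A w s C : R).
Hypotheses (mY : measurable_fun setT Y) (iY : P.-integrable setT (EFin \o Y)).
Hypothesis k0 : 0 < k.
Hypothesis decay : forall t, 0 < t <= k ->
  `|cos_transform Y t| <= A / (1 + t ^+ 2) /\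
  `|sin_transform Y t| <= A / (1 + t ^+ 2).
Hypothesis s0 : 0 < s.
Hypothesis C0 : 0 < C.
Hypothesis approx : forall y,
  `|smooth_sign y - (if 0 <= y then s else - s)| <= C / (`|y| + pi) ^+ 2.

Let mZ c : measurable_fun setT (fun x => c - k * Y x).
Proof. by apply: measurable_funB => //; apply: measurable_funM. Qed.

Let fejer_cos (c : R) x :
  fejer (c - k * Y x) = \int[mu]_(t in I01) ((1 - t) * cos (t * (c - k * Y x) - 0)).
Proof. by apply: eq_Rintegral => t _; rewrite subr0. Qed.

Let mfejer : measurable_fun I01 (fun t : R => 1 - t).
Proof. by apply: measurable_funB. Qed.

Let ifejer c : P.-integrable setT (EFin \o (fun x => fejer (c - k * Y x))).
Proof.
rewrite (_ : (fun x => _) = (fun x =>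
    \int[mu]_(t in I01) ((1 - t) * cos (t * (c - k * Y x) - 0)))); last first.
  by apply/funext => x; exact: fejer_cos.
apply: (@integrable_Fubini_cos _ _ 0 (fun=> 1)) => //.
  by apply: (@bounded_integrable_prob _ 1) => // x; rewrite normr1.
move=> x t /andP[t0 t1]; rewrite normrM -[leRHS]mulr1 ler_pM ?cos_max//.
by rewrite ger0_norm ?subr_ge0// gerBl ltW.
Qed.

(** The expectation of the Fejer kernel is an average of the transforms of Y
    over the frequencies in ]0, k], where they are at most A / (1 + t^2). *)
Lemma mean_fejer_le c : \int[P]_x fejer (c - k * Y x) <= 4 * A / k.
Proof.
under eq_Rintegral do rewrite fejer_cos.
rewrite (@Fubini_cos _ _ 0 (fun=> 1)) => //; last 2 first.
  by apply: (@bounded_integrable_prob _ 1) => // x; rewrite normr1.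
  move=> x t /andP[t0 t1]; rewrite normrM -[leRHS]mulr1 ler_pM ?cos_max//.
  by rewrite ger0_norm ?subr_ge0// gerBl ltW.
have cV : continuous (fun t : R => (1 + (t * k) ^+ 2)^-1).
  apply: derivable_continuous => x; apply: derivableV; last exact: ex_derive.
  by rewrite gt_eqF// ltr_pwDl// sqr_ge0.
have cD : continuous (fun t : R => 2 * A * (1 + (t * k) ^+ 2)^-1).
  by move=> x; apply: cvgM; [exact: cvg_cst|exact: cV].
have A0 : 0 <= A.
  have [|H _] := @decay k; first by rewrite k0 lexx.
  have := le_trans (normr_ge0 _) H.
  by rewrite pmulr_lge0// invr_gt0 ltr_pwDl// sqr_ge0.
apply: le_trans (_ : \int[mu]_(t in I01) (2 * A * (1 + (t * k) ^+ 2)^-1) <= _).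
  apply: le_trans (ler_norm _) _; apply: norm_Rintegral_itv01_le.
  - apply: continuous_integrable_itv01 => t; apply: cvgM.
      by apply: cvgB; [exact: cvg_cst|exact: cvg_id].
    exact: continuous_cos_transform.
  - exact: continuous_integrable_itv01.
  move=> t /andP[t0 t1]; rewrite cos_transform_affine//.
  have [|Hc Hs] := @decay (t * k).
    by rewrite mulr_gt0//= ler_piMl// ltW.
  have t1' : `|1 - t| <= 1 by rewrite ger0_norm ?subr_ge0// gerBl ltW.
  rewrite normrM -[leRHS]mul1r ler_pM// (le_trans (ler_normD _ _))//.
  rewrite (_ : 2 * A * _ = A / (1 + (t * k) ^+ 2) + A / (1 + (t * k) ^+ 2)); last first.
    by rewrite -mulrDl mulr_natl mulr2n.
  rewrite lerD// normrM -[leRHS]mul1r ler_pM ?cos_max ?sin_max//.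
rewrite RintegralZl//; last exact: continuous_integrable_itv01.
apply: le_trans (_ : 2 * A * (2 / k) <= _).
  by rewrite ler_wpM2l ?mulr_ge0// Rintegral_itv01_cauchy.
by rewrite le_eqVlt; apply/orP; left; apply/eqP; field; rewrite gt_eqF.
Qed.

Let Z x := k * w - k * Y x.

Let iZ : P.-integrable setT (EFin \o (fun x => 2 * `|Z x|)).
Proof.
have iZ0 : P.-integrable setT (EFin \o Z).
  apply: (integrableB measurableT (f := cst (k * w)%R%:E)
    (g := fun x => (k%:E * (Y x)%:E)%E)); last exact: integrableZl.
  by apply: (@bounded_integrable_prob (fun=> k * w) `|k * w|).
apply: (integrableZl measurableT 2 (f := fun x => `|(Z x)%:E|%E)).
exact: integrable_abse iZ0.
Qed.

Let bohman_sin x t : 0 < t <= 1 ->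
  bohman t * (sin (t * Z x) / t) = bohman t / t * cos (t * Z x - pi / 2).
Proof. by move=> _; rewrite cosBpihalf mulrA [RHS]mulrAC. Qed.

Let smooth_signE x : smooth_sign (Z x) =
  \int[mu]_(t in I01) (bohman t / t * cos (t * Z x - pi / 2)).
Proof.
by apply: eq_Rintegral => t; rewrite inE/= in_itv/= => t01; exact: bohman_sin.
Qed.

Let mbohman : measurable_fun I01 (fun t : R => bohman t / t).
Proof.
apply: measurable_funM; last exact: measurable_inv_itv01.
apply: measurable_funTS; apply: continuous_measurable_fun.
exact: continuous_bohman.
Qed.

Let bohmanG x t : 0 < t <= 1 ->
  `|bohman t / t * cos (t * Z x - pi / 2)| <= 2 * `|Z x|.
Proof. by move=> t01; rewrite -bohman_sin//; exact: smooth_sign_integrand_le. Qed.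

Let ismooth : P.-integrable setT (EFin \o (fun x => smooth_sign (Z x))).
Proof.
rewrite (_ : (fun x => _) = (fun x =>
    \int[mu]_(t in I01) (bohman t / t * cos (t * Z x - pi / 2)))); last first.
  by apply/funext => x; exact: smooth_signE.
exact: (integrable_Fubini_cos mbohman (mZ _) iZ bohmanG).
Qed.

(** The factor 1 / t is harmless: the transform of the phase pi / 2, an expected
    sine, is O(t). *)
Lemma integrable_transform_weight : mu.-integrable I01
  (EFin \o (fun t => bohman t / t * \int[P]_x cos (t * Z x - pi / 2))).
Proof.
apply: (@integrable_itv01 _ _ (\int[P]_x (2 * `|Z x|))).
  apply: measurable_funM => //; apply: measurable_funTS.
  by apply: continuous_measurable_fun; exact: (continuous_cos_transform (mZ _)).
move=> t t01.
have mt : measurable_fun setT (fun x => t * Z x - pi / 2).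
  apply: measurable_funB => //.
  exact: (measurable_funM (f := cst t) (g := Z) _ (mZ _)).
have ic := integrable_cos mt.
have ic' := integrableZl measurableT (bohman t / t) ic.
rewrite -RintegralZl//; apply: le_trans (le_normr_Rintegral measurableT ic') _.
apply: le_Rintegral => //; first exact: (integrable_norm ic').
by move=> x _; exact: bohmanG.
Qed.

(** The left-hand side is the expectation of sgn (k (w - Y)) - smooth_sign (k (w - Y)),
    with the sign scaled by s: by Fubini the integral is the expectation of
    the smoothed sign. The pointwise error C / (|y| + pi)^2 is dominated by two Fejer
    kernels, whose expectations are under control. *)
Lemma smoothing_error :
  `|s * (2 * fine (P [set x | Y x <= w]) - 1) -
    \int[mu]_(t in I01) (bohman t / t * \int[P]_x cos (t * Z x - pi / 2))|
  <= 4 * C * A / k.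
Proof.
have mYw : measurable [set x | Y x <= w].
  rewrite -[X in measurable X]setTI.
  have -> : [set x | Y x <= w] = Y @^-1` `]-oo, w].
    by apply/seteqP; split => x /=; rewrite in_itv.
  exact: mY.
pose D : set T := [set x | Y x <= w].
pose sg x : R := s * (2 * \1_D x - 1).
have isg : P.-integrable setT (EFin \o sg).
  apply: (@bounded_integrable_prob _ s).
    apply: measurable_funM => //; apply: measurable_funB => //.
    by apply: measurable_funM.
  move=> x; rewrite /sg normrM gtr0_norm// -[leRHS]mulr1 ler_wpM2l ?(ltW s0)//.
  rewrite indicE; case: (x \in D) => /=.
    by rewrite mulr1 (_ : 2 - 1 = 1)// ?normr1//; lra.
  by rewrite mulr0 sub0r normrN1.
have -> : s * (2 * fine (P D) - 1) = \int[P]_x sg x.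
  have iD : P.-integrable setT (EFin \o (\1_D : T -> R)).
    apply: (@bounded_integrable_prob _ 1) => // x.
    by rewrite indicE; case: (x \in D); rewrite ?normr1 ?normr0.
  have i1 : P.-integrable setT (EFin \o (fun=> 1)).
    by apply: (@bounded_integrable_prob _ 1) => // x; rewrite normr1.
  have i2 : P.-integrable setT (EFin \o (fun x => 2 * \1_D x)).
    exact: (integrableZl measurableT 2 iD).
  rewrite /sg RintegralZl//; last first.
    exact: (integrableB measurableT i2 i1).
  have c1 : \int[P]_x (1 : R) = 1.
    rewrite Rintegral_cst// mul1r; exact: (congr1 fine (probability_setT P)).
  rewrite RintegralB// RintegralZl// c1.
  by rewrite /Rintegral integral_indic// setIT.
rewrite -(Fubini_cos mbohman (mZ _) iZ bohmanG).
under [X in `|_ - X|]eq_Rintegral do rewrite -smooth_signE.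
rewrite -RintegralB//.
have i12 := integrableB measurableT isg ismooth.
apply: le_trans (le_normr_Rintegral measurableT i12) _.
pose f1 x := fejer (k * w - k * Y x); pose f2 x := fejer (k * w + pi - k * Y x).
have if12 := integrableD measurableT (ifejer (k * w)) (ifejer (k * w + pi)).
apply: le_trans (_ : \int[P]_x (C / 2 * (f1 x + f2 x)) <= _).
  apply: le_Rintegral => //.
  - exact: integrable_norm.
  - exact: (integrableZl measurableT (C / 2) if12).
  move=> x _; have := approx (Z x); have := fejer_pair_ge (Z x).
  have -> : f2 x = fejer (Z x + pi) by rewrite /f2 /Z; congr fejer; ring.
  rewrite -/(f1 x) => h1; rewrite distrC.
  have -> : sg x = if 0 <= Z x then s else - s.
    rewrite /sg /Z indicE -mulrBr pmulr_rge0// subr_ge0.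
    have [xw|xw] := leP (Y x) w.
      rewrite mem_set//= mulr1; lra.
    rewrite memNset/= ?mulr0; first lra.
    by rewrite /D/= => /(lt_le_trans xw); rewrite ltxx.
  move=> /le_trans; apply.
  apply: le_trans (_ : C / 2 * (2 / (`|Z x| + pi) ^+ 2) <= _).
    rewrite [C / 2 * _]mulrA divfK//.
  by rewrite ler_pM2l ?divr_gt0.
rewrite (RintegralZl _ measurableT if12).
rewrite (RintegralD measurableT (ifejer (k * w)) (ifejer (k * w + pi))).
apply: le_trans (_ : C / 2 * (4 * A / k + 4 * A / k) <= _).
  by rewrite ler_pM2l ?divr_gt0// lerD// mean_fejer_le.
by rewrite le_eqVlt; apply/orP; left; apply/eqP; field; rewrite gt_eqF.
Qed.

End smoothing.

End characteristic_function.

(** * The smoothing inequality *)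

Section smoothing_inequality.
Context {R : realType}.
Notation mu := (@lebesgue_measure R).
Notation I01 := (`]0, 1]%classic : set R).

Definition transform_decay d (T : measurableType d) (P : probability T R)
    (Y : T -> R) (A k : R) := forall t, 0 < t <= k ->
  `|cos_transform P Y t| <= A / (1 + t ^+ 2) /\
  `|sin_transform P Y t| <= A / (1 + t ^+ 2).

(** Once both signs are smoothed, the difference of the two expectations is an
    integral over ]0, 1] of the difference of the transforms at t k, against a
    weight at most 2 / t; the bound B t / (1 + t^2) absorbs the singularity. *)
Lemma smoothing_inequality : exists2 K : R, 0 < K &
  forall d1 (T1 : measurableType d1) (P1 : probability T1 R) (Y1 : T1 -> R)
    d2 (T2 : measurableType d2) (P2 : probability T2 R) (Y2 : T2 -> R)
    (A B k : R),
  measurable_fun setT Y1 -> P1.-integrable setT (EFin \o Y1) ->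
  measurable_fun setT Y2 -> P2.-integrable setT (EFin \o Y2) ->
  0 < k ->
  transform_decay P1 Y1 A k -> transform_decay P2 Y2 A k ->
  (forall t, 0 < t <= k ->
    `|cos_transform P1 Y1 t - cos_transform P2 Y2 t| <= B * t / (1 + t ^+ 2) /\
    `|sin_transform P1 Y1 t - sin_transform P2 Y2 t| <= B * t / (1 + t ^+ 2)) ->
  forall w, `|fine (P1 [set x | Y1 x <= w]) - fine (P2 [set x | Y2 x <= w])| <=
    K * (A / k + B).
Proof.
have [s [C [s0 C0 approx]]] := @smooth_sign_approx R.
exists (4 * (C + 1) / s); first by rewrite divr_gt0// mulr_gt0//; lra.
move=> d1 T1 P1 Y1 d2 T2 P2 Y2 A B k m1 i1 m2 i2 k0 dec1 dec2 dif w.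
have e1 := smoothing_error w m1 i1 k0 dec1 s0 C0 approx.
have e2 := smoothing_error w m2 i2 k0 dec2 s0 C0 approx.
have w1 := integrable_transform_weight k w m1 i1.
have w2 := integrable_transform_weight k w m2 i2.
have A0 : 0 <= A.
  have [|H _] := dec1 k; first by rewrite k0 lexx.
  have := le_trans (normr_ge0 _) H.
  by rewrite pmulr_lge0// invr_gt0 ltr_pwDl// sqr_ge0.
have B0 : 0 <= B.
  have [|H _] := dif k; first by rewrite k0 lexx.
  have := le_trans (normr_ge0 _) H.
  rewrite pmulr_lge0; last by rewrite invr_gt0 ltr_pwDl// sqr_ge0.
  by rewrite pmulr_lge0.
set p1 := fine _ in e1 *; set p2 := fine _ in e2 *.
set I1 := \int[mu]_(t in I01) _ in e1; set I2 := \int[mu]_(t in I01) _ in e2.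
have cV : continuous (fun t : R => 4 * B * k * (1 + (t * k) ^+ 2)^-1).
  apply: derivable_continuous => x; apply: derivableM; first exact: ex_derive.
  apply: derivableV; last exact: ex_derive.
  by rewrite gt_eqF// ltr_pwDl// sqr_ge0.
have cV1 : continuous (fun t : R => (1 + (t * k) ^+ 2)^-1).
  apply: derivable_continuous => x; apply: derivableV; last exact: ex_derive.
  by rewrite gt_eqF// ltr_pwDl// sqr_ge0.
have e3 : `|I1 - I2| <= 8 * B.
  rewrite /I1 /I2 -RintegralB//.
  apply: le_trans (_ : \int[mu]_(t in I01) (4 * B * k * (1 + (t * k) ^+ 2)^-1) <= _).
    apply: norm_Rintegral_itv01_le.
    - by have := integrableB _ w1 w2; apply.
    - exact: continuous_integrable_itv01.
    move=> t /[dup] t01 /andP[t0 t1]; rewrite -mulrBr !cos_transform_affine//.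
    have tk : 0 < t * k <= k by rewrite mulr_gt0//= ler_piMl// ltW.
    have [Hc Hs] := dif _ tk.
    rewrite opprD addrACA -!mulrBr normrM.
    apply: le_trans (_ : 2 / t * (2 * (B * (t * k) / (1 + (t * k) ^+ 2))) <= _).
      rewrite ler_pM// ?normr_ge0//.
        by rewrite normrM normfV (gtr0_norm t0) ler_pM2r ?invr_gt0// bohman_le2.
      rewrite (le_trans (ler_normD _ _))// mulr_natl mulr2n lerD// normrM.
        by rewrite -[leRHS]mul1r ler_pM// cos_max.
      by rewrite -[leRHS]mul1r ler_pM// sin_max.
    rewrite le_eqVlt; apply/orP; left; apply/eqP; field.
    by rewrite (gt_eqF t0) andbT gt_eqF// ltr_pwDl// sqr_ge0.
  rewrite RintegralZl//; last exact: continuous_integrable_itv01.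
  apply: le_trans (_ : 4 * B * k * (2 / k) <= _).
    by rewrite ler_wpM2l ?mulr_ge0 ?(ltW k0)// Rintegral_itv01_cauchy.
  by rewrite le_eqVlt; apply/orP; left; apply/eqP; field; rewrite gt_eqF.
have key : s * `|p1 - p2| <= 4 * C * (A / k) + 4 * B.
  rewrite -(gtr0_norm s0) -normrM.
  move: e1 e2 e3; rewrite !ler_norml.
  have -> : 4 * C * A / k = 4 * C * (A / k) by rewrite mulrA.
  move: (A / k) => q /andP[a1 a2] /andP[a3 a4] /andP[a5 a6].
  by apply/andP; split; lra.
have q0 : 0 <= A / k by rewrite divr_ge0// ltW.
rewrite mulrAC ler_pdivlMr// mulrC; apply: le_trans key _.
by move: (A / k) q0 => q q0; nra.
Qed.

End smoothing_inequality.

(** * Transforms of the standard normal law *)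

Section standard_normal.
Context {R : realType}.
Notation mu := (@lebesgue_measure R).
Notation phi := (@normal_pdf R 0 1).

Lemma normal_pdf01E x : phi x = normal_peak 1 * expR (- (x ^+ 2) / 2).
Proof.
rewrite normal_pdfE ?oner_neq0// /normal_fun subr0 expr1n.
by rewrite mulNr.
Qed.

Lemma measurable_phi : measurable_fun setT phi.
Proof. exact: measurable_normal_pdf. Qed.

Lemma integrable_phi : mu.-integrable setT (EFin \o phi).
Proof. exact: integrable_normal_pdf. Qed.

Lemma integrable_dominated (f g : R -> R) : measurable_fun setT f ->
  mu.-integrable setT (EFin \o g) -> (forall x, `|f x| <= g x) ->
  mu.-integrable setT (EFin \o f).
Proof.
move=> mf ig fg; apply: (le_integrable measurableT _ _ ig).
  exact/measurable_EFinP.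
by move=> x _ /=; rewrite lee_fin (le_trans (fg x))// ler_norm.
Qed.

(** The density of variance 2 dominates, up to a constant, the standard one
    multiplied by 1 + |x|: indeed 1 + |x| <= 2 (1 + x^2 / 4) <= 2 e^{x^2/4}. *)
Lemma phi_first_moment : exists2 g : R -> R,
  mu.-integrable setT (EFin \o g) & forall x, (1 + `|x|) * phi x <= g x.
Proof.
pose s : R := Num.sqrt 2.
have s0 : s != 0 by rewrite gt_eqF// sqrtr_gt0.
have pk : 0 < normal_peak s by exact: normal_peak_gt0.
pose c := 2 * normal_peak 1 / normal_peak s.
exists (fun x => c * normal_pdf 0 s x).
  exact: (integrableZl measurableT c (integrable_normal_pdf 0 s)).
move=> x; rewrite normal_pdf01E normal_pdfE// /normal_fun subr0 sqr_sqrtr//.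
have p1 : 0 <= normal_peak 1 :> R by exact: normal_peak_ge0.
rewrite mulrCA /c.
have -> : 2 * normal_peak 1 / normal_peak s *
  (normal_peak s * expR (- x ^+ 2 / (2 *+ 2))) =
  normal_peak 1 * (2 * expR (- x ^+ 2 / (2 *+ 2))).
  by field; rewrite gt_eqF.
rewrite ler_wpM2l//.
have -> : - x ^+ 2 / 2 = - x ^+ 2 / (2 *+ 2) + - x ^+ 2 / (2 *+ 2) by field.
rewrite expRD mulrA ler_wpM2r ?expR_ge0//.
rewrite mulNr expRN -ler_pdivlMr ?invr_gt0 ?expR_gt0// invrK.
have := expR_ge1Dx (x ^+ 2 / (2 *+ 2)).
rewrite -(real_normK (num_real x)); have := normr_ge0 x.
move: (`|x|) (expR _) => y e y0; have := sqr_ge0 (y - 2).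
nra.
Qed.

Lemma integrable_x_phi (f : R -> R) (c : R) : measurable_fun setT f ->
  (forall x, `|f x| <= c * (1 + `|x|)) ->
  mu.-integrable setT (EFin \o (fun x => f x * phi x)).
Proof.
move=> mf fc; have [g ig gP] := phi_first_moment.
have ig' := integrableZl measurableT `|c| ig.
apply: (@integrable_dominated _ (fun x => `|c| * g x)) => //.
  by apply: measurable_funM => //; exact: measurable_phi.
move=> x; rewrite normrM (ger0_norm (normal_pdf_ge0 _ _ _)).
apply: le_trans (_ : `|c| * ((1 + `|x|) * phi x) <= _); last by rewrite ler_wpM2l.
rewrite mulrA ler_wpM2r ?normal_pdf_ge0// (le_trans (fc x))// ler_wpM2r//.
exact: ler_norm.
Qed.

Lemma is_derive_phi (x : R) : is_derive x 1 phi (- x * phi x).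
Proof.
have -> : phi = fun x => normal_peak 1 * expR (- (x ^+ 2) / 2).
  by apply/funext => y; rewrite normal_pdf01E.
by apply: trigger_derive; rewrite /GRing.scale/=; field.
Qed.

(** The integral over [- n, n] is F n - F (- n), which tends to 0. *)
Lemma Rintegral_derive_eq0 (F f : R -> R) :
  (forall x : R, is_derive x 1 F (f x)) -> continuous f ->
  mu.-integrable setT (EFin \o f) ->
  (forall x, `|F x| <= phi x) -> \int[mu]_x f x = 0.
Proof.
move=> dF cf fi Fphi.
have cF : continuous F by apply: derivable_continuous => x; case: (dF x).
pose f_ (n : nat) : R -> \bar R := EFin \o (f \_ `[- n.+1%:R, n.+1%:R]).
have mf : measurable_fun setT f by exact: continuous_measurable_fun.
have mf_ n : measurable_fun setT (f_ n).
  apply/measurable_EFinP; apply/(measurable_restrict _ _ measurableT) => //.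
  by rewrite setTI; exact: measurable_funTS.
have f_f : {ae mu, forall x, setT x -> f_ n x @[n --> \oo] --> (f x)%:E}.
  apply/aeW => x _; apply: cvg_EFin; first exact: nearW.
  apply: cvg_near_cst; near=> n; rewrite /f_ /= patchE mem_set//= in_itv/=.
  rewrite -ler_norml; apply: ltW; apply: lt_le_trans (_ : n%:R <= _).
    by near: n; exact: nbhs_infty_gtr.
  by rewrite ler_nat.
have f_le : {ae mu, forall x n, setT x -> (`|f_ n x| <= (EFin \o (fun x => `|f x|%R)) x)%E}.
  apply/aeW => x n _; rewrite lee_fin /= patchE.
  by case: ifP => _ //; rewrite normr0.
have mf' : measurable_fun setT (EFin \o f) by exact/measurable_EFinP.
have fi' : mu.-integrable setT (EFin \o (fun x => `|f x|)).
  exact: integrable_norm.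
have H : (\int[mu]_x f_ n x)%E @[n --> \oo] --> (\int[mu]_x (f x)%:E)%E.
  have DC := @dominated_convergence _ _ _ mu setT measurableT f_ (EFin \o f)
    (EFin \o (fun x => `|f x|)).
  have [|||||_ _ //] := DC; [exact: mf_|exact: mf'|exact: f_f|exact: fi'|exact: f_le].
have E n : (\int[mu]_x f_ n x = (F n.+1%:R - F (- n.+1%:R))%:E)%E.
  rewrite EFinB -(@continuous_FTC2 R f F)//.
  - by rewrite [RHS]integral_mkcond; apply: eq_integral => x _; rewrite /f_ /= restrict_EFin.
  - by rewrite (@lt_trans _ _ 0)// ?oppr_lt0 ltr0n.
  - exact: continuous_subspaceT.
  - split.
    + by move=> x _; case: (dF x).
    + exact/cvg_at_right_filter/cF.
    + exact/cvg_at_left_filter/cF.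
  - by move=> x _; rewrite derive1E; case: (dF x).
have {}H : (F n.+1%:R - F (- n.+1%:R))%:E @[n --> \oo] --> (\int[mu]_x (f x)%:E)%E.
  by under eq_fun do rewrite -E.
have ffin : (\int[mu]_x (f x)%:E)%E \is a fin_num by exact: (integrable_fin_num _ fi).
move: H; rewrite -(fineK ffin) => /fine_cvgP[_ cv].
suff cv0 : F n.+1%:R - F (- n.+1%:R) @[n --> \oo] --> (0 : R).
  exact: (cvg_unique (@norm_hausdorff _ _) cv cv0).
apply: norm_cvg0.
apply: (@squeeze_cvgr _ _ _ _ (fun=> 0) (fun n : nat => 4 * normal_peak 1 * expR (- n%:R))).
- near=> n; rewrite normr_ge0/=.
  have p1 : 0 <= normal_peak 1 :> R by exact: normal_peak_ge0.
  have B (x : R) : x ^+ 2 = n.+1%:R ^+ 2 -> phi x <= 2 * normal_peak 1 * expR (- n%:R).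
    move=> xE; rewrite normal_pdf01E xE mulrC mulrAC ler_wpM2r//.
    apply: le_trans (_ : expR (- n%:R) <= _); last by rewrite ler_peMl ?expR_ge0// ler1n.
    rewrite ler_expR -natr1.
    have : 0 <= n%:R :> R by rewrite ler0n.
    by move: n%:R => y y0; nra.
  rewrite (le_trans (ler_normB _ _))//.
  have -> : 4 * normal_peak 1 * expR (- n%:R) =
    2 * normal_peak 1 * expR (- n%:R) + 2 * normal_peak 1 * expR (- n%:R) :> R.
    by ring.
  rewrite lerD// (le_trans (Fphi _))//; apply: B => //.
  by rewrite sqrrN.
- exact: cvg_cst.
- rewrite -[X in _ --> X](mulr0 (4 * normal_peak 1)).
  by apply: cvgM; [exact: cvg_cst|exact: cvgn_expR].
Unshelve. all: by end_near. Qed.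

Definition gauss_transform (b t : R) : R := \int[mu]_x (cos (t * x - b) * phi x).

Let cphase (b t : R) : continuous (fun x : R => t * x - b).
Proof. by apply: derivable_continuous => x; exact: ex_derive. Qed.

Let mcos (b t : R) : measurable_fun setT (fun x : R => cos (t * x - b)).
Proof.
apply: continuous_measurable_fun => x.
by apply: (@derivable_continuous R (fun x => cos (t * x - b))) => y; exact: ex_derive.
Qed.

Let msin (b t : R) : measurable_fun setT (fun x : R => sin (t * x - b)).
Proof.
apply: continuous_measurable_fun => x.
by apply: (@derivable_continuous R (fun x => sin (t * x - b))) => y; exact: ex_derive.
Qed.

Lemma integrable_cos_phi b t :
  mu.-integrable setT (EFin \o (fun x => cos (t * x - b) * phi x)).
Proof.
apply: (@integrable_x_phi _ 1) => // x.
by rewrite (le_trans (cos_max _))// mul1r lerDl.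
Qed.

Lemma integrable_x_sin_phi b t :
  mu.-integrable setT (EFin \o (fun x => (x * sin (t * x - b)) * phi x)).
Proof.
apply: (@integrable_x_phi _ 1).
  by apply: measurable_funM.
move=> x; rewrite normrM mul1r.
apply: le_trans (_ : `|x| * 1 <= _); first by rewrite ler_wpM2l// sin_max.
by rewrite mulr1 lerDr.
Qed.

(** x phi(x) is minus the derivative of phi, so that the derivative of
    sin (t x - b) phi(x) integrates to 0. *)
Lemma gauss_transform_by_parts b t :
  \int[mu]_x ((x * sin (t * x - b)) * phi x) = t * gauss_transform b t.
Proof.
have ic := integrable_cos_phi b t; have iS := integrable_x_sin_phi b t.
have ict := integrableZl measurableT t ic.
apply/esym/eqP; rewrite -subr_eq0 /gauss_transform -RintegralZl// -RintegralB//.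
apply/eqP; apply: (@Rintegral_derive_eq0 (fun x => sin (t * x - b) * phi x)).
- move=> x; have dp := is_derive_phi x.
  by apply: trigger_derive; rewrite /GRing.scale/=; ring.
- apply: derivable_continuous => x; have dp := is_derive_phi x.
  exact: ex_derive.
- exact: (integrableB measurableT ict iS).
- move=> x; rewrite normrM (ger0_norm (normal_pdf_ge0 _ _ _)).
  by rewrite -[leRHS]mul1r ler_wpM2r ?normal_pdf_ge0// sin_max.
Qed.

Lemma is_derive_gauss_transform b (t : R) :
  is_derive t 1 (gauss_transform b) (- t * gauss_transform b t).
Proof.
have [g ig gP] := phi_first_moment.
pose f (t x : R) := cos (t * x - b) * phi x.
have df (u x : R) : is_derive u 1 (f ^~ x) (- (x * sin (u * x - b) * phi x)).
  by apply: trigger_derive; rewrite /GRing.scale/=; ring.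
have tI : (`](t - 1), (t + 1)[)%classic t.
  by rewrite /= in_itv/=; apply/andP; split; lra.
have dE u x : partial1of2 f u x = - (x * sin (u * x - b) * phi x).
  by rewrite partial1of2E; case: (df u x).
have g0 x : 0 <= g x.
  by apply: le_trans (gP x); rewrite mulr_ge0 ?normal_pdf_ge0// addr_ge0.
have D : h^-1 *: (gauss_transform b (h + t) - gauss_transform b t) @[h --> 0^'] -->
    - t * gauss_transform b t.
  have -> : - t * gauss_transform b t = \int[mu]_x partial1of2 f t x.
    under eq_Rintegral do rewrite dE -mulN1r.
    rewrite RintegralZl//; last exact: integrable_x_sin_phi.
    by rewrite gauss_transform_by_parts mulN1r mulNr.
  apply: (@cvg_differentiation_under_integral R _ _ mu f setT _ t (t - 1) (t + 1)
    tI _ _ g) => //.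
  - by move=> u _; exact: integrable_cos_phi.
  - move=> u x _ _; rewrite dE normrN normrM (ger0_norm (normal_pdf_ge0 _ _ _)).
    apply: le_trans (gP x); rewrite ler_wpM2r ?normal_pdf_ge0// normrM.
    apply: le_trans (_ : `|x| * 1 <= _); first by rewrite ler_wpM2l// sin_max.
    by rewrite mulr1 lerDr.
apply: DeriveDef.
  apply/cvg_ex; exists (- t * gauss_transform b t); under eq_fun do rewrite scaler1; exact: D.
rewrite -derive1E; apply/cvg_lim => //; exact: D.
Qed.

(** The transform solves y' = - t y. *)
Lemma gauss_transformE b t : gauss_transform b t = cos b * expR (- t ^+ 2 / 2).
Proof.
pose h (u : R) := gauss_transform b u * expR (u ^+ 2 / 2).
have hc : h t = h 0.
  apply: is_derive_0_is_cst => u; have dg := is_derive_gauss_transform b u.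
  by apply: trigger_derive; rewrite /GRing.scale/=; field.
have h0 : h 0 = cos b.
  rewrite /h expr0n/= mul0r expR0 mulr1 /gauss_transform.
  under eq_Rintegral do rewrite mul0r sub0r cosN.
  rewrite RintegralZl//; last exact: integrable_phi.
  by rewrite /Rintegral integral_normal_pdf mulr1.
by rewrite -h0 -hc /h -mulrA -expRD mulNr addrN expR0 mulr1.
Qed.

(** The Radon-Nikodym derivative of the normal law coincides almost everywhere
    with the density, as both have the same integrals. *)
Lemma ge0_integral_normal (f : R -> R) : measurable_fun setT f ->
  (forall x, 0 <= f x) ->
  (\int[@normal_prob R 0 1]_x (f x)%:E = \int[mu]_x (f x * phi x)%:E)%E.
Proof.
move=> mf f0; have dom : normal_prob (0 : R) 1 `<< mu by exact: normal_prob_dominates.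
have mf' : measurable_fun setT (EFin \o f) by exact/measurable_EFinP.
have mp : measurable_fun setT (EFin \o phi) by apply/measurable_EFinP; exact: measurable_phi.
have iRN := Radon_Nikodym_SigmaFinite.f_integrable dom.
rewrite -(Radon_Nikodym_SigmaFinite.change_of_variables dom (f := EFin \o f))//.
apply: ae_eq_integral => //.
- by apply: emeasurable_funM => //; exact: measurable_int iRN.
- by apply/measurable_EFinP; apply: measurable_funM => //; exact: measurable_phi.
have H : ae_eq mu setT (Radon_Nikodym_SigmaFinite.f (normal_prob (0 : R) 1) mu) (EFin \o phi).
  apply: integral_ae_eq => // E _ mE.
  by rewrite -Radon_Nikodym_SigmaFinite.f_integral.
by apply: filterS H => x /= Hx _; rewrite Hx// EFinM.
Qed.

Lemma Rintegral_normal_cos b t :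
  \int[@normal_prob R 0 1]_x cos (t * x - b) = cos b * expR (- t ^+ 2 / 2).
Proof.
rewrite -gauss_transformE /gauss_transform.
have ic := integrable_cos_phi b t; have ip := integrable_phi.
have m1 : measurable_fun setT (fun x : R => t * x - b).
  by apply: continuous_measurable_fun; exact: cphase.
have icn := @integrable_cos R _ _ (@normal_prob R 0 1) _ m1.
have i1 : (@normal_prob R 0 1).-integrable setT (EFin \o (fun=> 1)).
  by apply: (@bounded_integrable_prob _ _ _ _ _ 1) => // x; rewrite normr1.
have E : \int[@normal_prob R 0 1]_x (1 + cos (t * x - b)) =
  \int[mu]_x ((1 + cos (t * x - b)) * phi x).
  rewrite /Rintegral ge0_integral_normal//.
    by apply: measurable_funD.
move: E; rewrite RintegralD//.
under [RHS]eq_Rintegral do rewrite mulrDl mul1r.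
rewrite RintegralD//.
have -> : \int[mu]_x phi x = 1 by rewrite /Rintegral integral_normal_pdf.
have -> : \int[@normal_prob R 0 1]_x (1 : R) = 1.
  rewrite Rintegral_cst// mul1r; exact: (congr1 fine (probability_setT (@normal_prob R 0 1))).
exact: addrI.
Qed.

Lemma integrable_normal_id : (@normal_prob R 0 1).-integrable setT (EFin \o id).
Proof.
apply/integrableP; split; first exact/measurable_EFinP.
rewrite (@ge0_integral_normal (fun x => `|x|))//.
have /integrableP[_] : mu.-integrable setT (EFin \o (fun x => `|x| * phi x)).
  apply: (@integrable_x_phi _ 1); first exact: normr_measurable.
  by move=> x; rewrite normr_id mul1r lerDr.
under eq_integral do rewrite /= ger0_norm ?mulr_ge0 ?normal_pdf_ge0//.
exact.
Qed.

Lemma normal_cdfE (w : R) :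
  fine (@normal_prob R 0 1 [set x | x <= w]) = normal_cdf w.
Proof.
rewrite /normal_cdf.
have -> : [set x | x <= w] = `]-oo, w]%classic :> set R.
  by apply/seteqP; split => x /=; rewrite in_itv.
have ip : mu.-integrable `]-oo, w] (EFin \o phi).
  by apply: integrableS integrable_phi.
have pk : normal_peak 1 = (Num.sqrt (2 * pi))^-1 :> R.
  by rewrite /normal_peak expr1n mul1r mulr_natl.
have pk0 : normal_peak 1 != 0 :> R by rewrite gt_eqF// normal_peak_gt0.
rewrite -pk -RintegralZl//.
  by rewrite /Rintegral /normal_prob; congr fine; apply: eq_integral => x _; rewrite normal_pdf01E.
rewrite (_ : EFin \o _ = fun x => ((normal_peak 1)^-1%:E * (phi x)%:E)%E); last first.
  apply/funext => x /=; rewrite -EFinM normal_pdf01E mulKf//.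
exact: integrableZl.
Qed.

End standard_normal.

(** * Cumulants of generating polynomials *)

Section polynomial_cumulants.
Context {R : realFieldType}.
Implicit Types (f g : {poly R}) (x m : R).

(** If f is the generating function of X, this is the factorial moment
    E X (X - 1) ... (X - j + 1). *)
Definition fmoment f (j : nat) : R := f^`(j).[1].

Definition mean_poly f : R := fmoment f 1.

Definition variance_poly f : R := fmoment f 2 + fmoment f 1 - fmoment f 1 ^+ 2.

(** The central moment E (X - m)^4, expanded on the falling factorials through
    x^4 = x(x-1)(x-2)(x-3) + 6 x(x-1)(x-2) + 7 x(x-1) + x and similar formulas
    for x^3 and x^2. *)
Definition fourth_moment_poly f : R :=
  let m := fmoment f 1 in
  fmoment f 4 + (6 - 4 * m) * fmoment f 3
  + (7 - 12 * m + 6 * m ^+ 2) * fmoment f 2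
  + (1 - 4 * m + 6 * m ^+ 2 - 4 * m ^+ 3) * m + m ^+ 4.

Definition cumulant4_poly f : R := fourth_moment_poly f - 3 * variance_poly f ^+ 2.

(** Leibniz rule at 1. *)
Lemma fmomentM f g : f.[1] = 1 -> g.[1] = 1 ->
  [/\ fmoment (f * g) 1 = fmoment f 1 + fmoment g 1,
      fmoment (f * g) 2 = fmoment f 2 + 2 * fmoment f 1 * fmoment g 1 + fmoment g 2,
      fmoment (f * g) 3 = fmoment f 3 + 3 * fmoment f 2 * fmoment g 1
        + 3 * fmoment f 1 * fmoment g 2 + fmoment g 3 &
      fmoment (f * g) 4 = fmoment f 4 + 4 * fmoment f 3 * fmoment g 1
        + 6 * fmoment f 2 * fmoment g 2 + 4 * fmoment f 1 * fmoment g 3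
        + fmoment g 4].
Proof.
move=> f1 g1; rewrite /fmoment.
split; rewrite /= !(derivM, derivD) !(hornerD, hornerM) f1 g1; ring.
Qed.

Lemma mean_polyM f g : f.[1] = 1 -> g.[1] = 1 ->
  mean_poly (f * g) = mean_poly f + mean_poly g.
Proof. by move=> f1 g1; have [] := fmomentM f1 g1. Qed.

Lemma variance_polyM f g : f.[1] = 1 -> g.[1] = 1 ->
  variance_poly (f * g) = variance_poly f + variance_poly g.
Proof.
move=> f1 g1; rewrite /variance_poly.
by have [-> -> _ _] := fmomentM f1 g1; ring.
Qed.

(** A polynomial identity between factorial moments; no independent random
    variables stand behind the factors, whose coefficients may be negative. *)
Lemma cumulant4_polyM f g : f.[1] = 1 -> g.[1] = 1 ->
  cumulant4_poly (f * g) = cumulant4_poly f + cumulant4_poly g.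
Proof.
move=> f1 g1; rewrite /cumulant4_poly /fourth_moment_poly /variance_poly.
by have [-> -> -> ->] := fmomentM f1 g1; ring.
Qed.

Section product.
Variables (I : Type) (F : I -> {poly R}).
Hypothesis F1 : forall i, (F i).[1] = 1.

Lemma horner_prod1 (s : seq I) : (\prod_(i <- s) F i).[1] = 1.
Proof. by rewrite horner_prod big1. Qed.

Lemma fmoment1 j : fmoment 1 j.+1 = 0.
Proof. by rewrite /fmoment derivSn derivC linear0 horner0. Qed.

Lemma mean_poly_prod (s : seq I) :
  mean_poly (\prod_(i <- s) F i) = \sum_(i <- s) mean_poly (F i).
Proof.
elim: s => [|i s IH]; first by rewrite !big_nil /mean_poly fmoment1.
by rewrite !big_cons mean_polyM ?IH// horner_prod1.
Qed.

Lemma variance_poly_prod (s : seq I) :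
  variance_poly (\prod_(i <- s) F i) = \sum_(i <- s) variance_poly (F i).
Proof.
elim: s => [|i s IH].
  by rewrite !big_nil /variance_poly !fmoment1 addr0 expr0n subr0.
by rewrite !big_cons variance_polyM ?IH// horner_prod1.
Qed.

Lemma cumulant4_poly_prod (s : seq I) :
  cumulant4_poly (\prod_(i <- s) F i) = \sum_(i <- s) cumulant4_poly (F i).
Proof.
elim: s => [|i s IH].
  rewrite !big_nil /cumulant4_poly /fourth_moment_poly /variance_poly !fmoment1.
  by ring.
by rewrite !big_cons cumulant4_polyM ?IH// horner_prod1.
Qed.

End product.

Definition bernoulli_poly (p : R) : {poly R} := (1 - p)%:P + p *: 'X.

Lemma bernoulli_poly1 p : (bernoulli_poly p).[1] = 1.
Proof. by rewrite /bernoulli_poly !hornerE subrK. Qed.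

Lemma deriv_bernoulli_poly p : (bernoulli_poly p)^`() = p%:P.
Proof. by rewrite derivD derivC derivZ derivX add0r alg_polyC. Qed.

Lemma mean_bernoulli_poly p : mean_poly (bernoulli_poly p) = p.
Proof. by rewrite /mean_poly /fmoment /= deriv_bernoulli_poly hornerC. Qed.

Lemma variance_bernoulli_poly p : variance_poly (bernoulli_poly p) = p * (1 - p).
Proof.
rewrite /variance_poly /fmoment /= deriv_bernoulli_poly derivC horner0 hornerC.
by ring.
Qed.

(** For z on the unit circle and a = 1 / (1 - Re z), this is the real polynomial
    (X - z)(X - conj z) / |1 - z|^2, which is 1 at 1. *)
Definition circle_poly (a : R) : {poly R} := 'X + (a / 2) *: ('X - 1%:P) ^+ 2.

Lemma circle_poly1 a : (circle_poly a).[1] = 1.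
Proof.
rewrite /circle_poly expr2 hornerD hornerZ hornerM hornerXsubC hornerX.
by rewrite subrr !mulr0 addr0.
Qed.

Lemma fmoment_circle_poly a :
  [/\ fmoment (circle_poly a) 1 = 1, fmoment (circle_poly a) 2 = a,
      fmoment (circle_poly a) 3 = 0 & fmoment (circle_poly a) 4 = 0].
Proof.
rewrite /fmoment /circle_poly expr2 /=.
have E : ('X + (a / 2) *: (('X - 1%:P) * ('X - 1%:P)))^`() = 1 + a *: ('X - 1%:P).
  rewrite derivD derivX derivZ derivM derivB derivX derivC subr0 mul1r mulr1.
  by rewrite -mulr2n -scalerMnr scalerMnl -mulr_natr divfK.
have E2 : (1 + a *: ('X - 1%:P))^`() = a%:P.
  by rewrite derivD derivC derivZ derivB derivX derivC subr0 add0r alg_polyC.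
rewrite E E2; split; first by rewrite !hornerE subrr mulr0 addr0.
- by rewrite hornerC.
- by rewrite derivC horner0.
- by rewrite !derivC horner0.
Qed.

Lemma mean_circle_poly a : mean_poly (circle_poly a) = 1.
Proof. by have [] := fmoment_circle_poly a. Qed.

Lemma variance_circle_poly a : variance_poly (circle_poly a) = a.
Proof.
rewrite /variance_poly; have [-> -> _ _] := fmoment_circle_poly a; ring.
Qed.

Lemma cumulant4_circle_poly a : cumulant4_poly (circle_poly a) = a - 3 * a ^+ 2.
Proof.
rewrite /cumulant4_poly variance_circle_poly /fourth_moment_poly.
by have [-> -> -> ->] := fmoment_circle_poly a; ring.
Qed.

End polynomial_cumulants.

(** * Factorization of generating polynomials along their roots *)

Section root_factorization.
Context {R : realType}.
Implicit Types (q : {poly R}) (z : R[i]).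
Local Open Scope complex_scope.

Notation toC := (real_complex R).

Lemma map_bernoulli_poly (p : R) :
  map_poly toC (bernoulli_poly p) = (1 - p)%:C%:P + p%:C *: 'X.
Proof. by rewrite /bernoulli_poly [LHS]rmorphD/= map_polyC map_polyZ/= map_polyX. Qed.

Lemma map_circle_poly (a : R) : map_poly toC (circle_poly a) =
  'X + (a / 2)%:C *: ('X - 1%:P) ^+ 2.
Proof.
rewrite /circle_poly [LHS]rmorphD/= map_polyX map_polyZ/= !rmorphXn/=.
by rewrite rmorphB/= map_polyX map_polyC/=.
Qed.

(** The value 1 at 1 determines the leading coefficient. *)
Lemma normalized_root_product q : q.[1] = 1 ->
  exists2 rs : seq R[i], (forall z, z \in rs -> root (map_poly toC q) z) &
    (forall z, z \in rs -> 1 - z != 0) /\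
    map_poly toC q = \prod_(z <- rs) ((1 - z)^-1 *: ('X - z%:P)).
Proof.
move=> q1.
have [rs E] := closed_field_poly_normal (map_poly toC q).
have qC1 : (map_poly toC q).[1] = 1.
  by rewrite -(rmorph1 toC) horner_map/= q1.
have lc0 : lead_coef (map_poly toC q) != 0.
  by rewrite lead_coef_eq0; apply: contra_eq_neq qC1 => ->; rewrite horner0 eq_sym oner_eq0.
set lc := lead_coef _ in E lc0.
have rrs z : z \in rs -> root (map_poly toC q) z.
  by move=> zrs; rewrite E rootZ// root_prod_XsubC.
have nz z : z \in rs -> 1 - z != 0.
  move=> /rrs rz; rewrite subr_eq0; apply: contraTneq rz => <-.
  by rewrite rootE qC1 oner_eq0.
exists rs => //; split=> //.
rewrite scaler_prod -[LHS]/(map_poly toC q) [LHS]E; congr (_ *: _).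
apply: (@mulIf _ (\prod_(z <- rs) (1 - z))).
  by rewrite prodf_seq_neq0; apply/allP => z zrs; rewrite nz.
rewrite -big_split/= [RHS]big_seq [RHS]big1; last first.
  by move=> z zrs; rewrite mulVf// nz.
rewrite -[RHS]qC1 E hornerZ horner_prod; congr (_ * _).
by apply: eq_bigr => z _; rewrite hornerXsubC.
Qed.

Lemma real_rooted_factorization q : q.[1] = 1 -> real_rooted (map_poly toC q) ->
  exists2 ps : seq R, (forall p, p \in ps -> 0 <= p <= 1) &
    q = \prod_(p <- ps) bernoulli_poly p.
Proof.
move=> q1 rr; have [rs rootrs [_ E]] := normalized_root_product q1.
exists [seq (1 - complex.Re z)^-1 | z <- rs].
  move=> p /mapP[z /rootrs/rr[x x0 ->] ->] /=.
  have x1 : 1 <= 1 - x by lra.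
  by rewrite invr_ge0 invf_le1; [apply/andP; split; lra|lra].
apply: (map_poly_inj (real_complex R)).
rewrite E rmorph_prod big_map !(big_seq _ _ rs); apply: eq_bigr => z zrs.
have [x x0 ->] := rr _ (rootrs _ zrs).
have x1 : 1 - x != 0 by rewrite gt_eqF//; lra.
have -> : 1 - x%:C = (1 - x)%:C by rewrite rmorphB rmorph1.
rewrite [RHS]map_bernoulli_poly [RHS]addrC /=.
rewrite -fmorphV scalerBr; congr (_ + _).
rewrite -scalerN -mul_polyC -polyCN -polyCM; congr (_%:P).
by apply/eqP; rewrite eq_complex/=; apply/andP; split; apply/eqP; [field|ring].
Qed.

(** |1 - z|^2 = 2 (1 - Re z) on the unit circle. *)
Lemma circle_pair (z : R[i]) : `|z| = 1 -> 1 - z != 0 ->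
  2^-1 <= (1 - complex.Re z)^-1 /\
  (1 - z)^-1 *: ('X - z%:P) * ((1 - z^*)^-1 *: ('X - (z^*)%:P)) =
  map_poly toC (circle_poly (1 - complex.Re z)^-1).
Proof.
case: z => c s; rewrite normc_def/= => nz z1.
have cs : c ^+ 2 + s ^+ 2 = 1.
  move: nz => /complexI => nz; rewrite -(sqr_sqrtr (_ : 0 <= c ^+ 2 + s ^+ 2)).
    by rewrite nz expr1n.
  by rewrite addr_ge0// sqr_ge0.
have c1 : c < 1.
  rewrite lt_neqAle; apply/andP; split; last by nra.
  apply: contraNneq z1 => cE; move: cs; rewrite cE expr1n => /eqP.
  rewrite -subr_eq0 addrC addKr sqrf_eq0 => /eqP ->.
  by rewrite subr_eq0.
have c2 : -1 <= c by nra.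
have d0 : 1 - c != 0 by rewrite subr_eq0 gt_eqF.
split; first by rewrite lef_pV2 ?posrE; lra.
rewrite map_circle_poly.
rewrite -!scalerAl -!scalerAr scalerA -invfM.
have -> : (1 - (c +i* s)) * (1 - (c -i* s)) = (2 * (1 - c))%:C.
  by apply/eqP; rewrite eq_complex/=; apply/andP; split; apply/eqP; [nra|ring].
have d0' : (2 * (1 - c))%:C != 0 by rewrite fmorph_eq0 mulf_neq0.
have -> : ((1 - c)^-1 / 2)%:C = (2 * (1 - c))%:C^-1.
  by rewrite -fmorphV invfM mulrC.
apply: (scalerI d0'); rewrite scalerDr !scalerA mulfV// !scale1r.
have -> : ('X - (c +i* s)%:P) * ('X - (c -i* s)%:P) =
  'X ^+ 2 - (2 * c)%:C *: 'X + 1%:P :> {poly R[i]}.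
  have e1 : (c +i* s) + (c -i* s) = (2 * c)%:C.
    by apply/eqP; rewrite eq_complex/=; apply/andP; split; apply/eqP; ring.
  have e2 : (c +i* s) * (c -i* s) = 1.
    by apply/eqP; rewrite eq_complex/=; apply/andP; split; apply/eqP; [nra|ring].
  rewrite -e1 -e2 -mul_polyC polyCM polyCD; ring.
have -> : (2 * (1 - c))%:C = 2 - (2 * c)%:C.
  by rewrite mulrBr mulr1 rmorphB rmorph_nat.
rewrite scalerBl scaler_nat -mul_polyC polyC1; ring.
Qed.

(** The square is the product of the polynomial, factored along its roots, and
    of its conjugate, which is the same polynomial factored along the conjugate
    roots. Conjugate roots thus need not be matched within the polynomial. *)
Lemma cyclotomic_factorization q : q.[1] = 1 -> cyclotomic (map_poly toC q) ->
  exists2 s : seq R, (forall a, a \in s -> 2^-1 <= a) &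
    q ^+ 2 = \prod_(a <- s) circle_poly a.
Proof.
move=> q1 cyc; have [rs rootrs [nz E]] := normalized_root_product q1.
exists [seq (1 - complex.Re z)^-1 | z <- rs].
  move=> a /mapP[z zrs ->].
  by have [] := circle_pair (cyc _ (rootrs _ zrs)) (nz _ zrs).
apply: (map_poly_inj (real_complex R)).
have EJ : map_poly toC q = \prod_(z <- rs) ((1 - z^*)^-1 *: ('X - (z^*)%:P)).
  have -> : map_poly toC q = map_poly conjc (map_poly toC q).
    rewrite -map_poly_comp; apply: eq_map_poly => x.
    by apply/eqP; rewrite eq_complex /= oppr0 !eqxx.
  rewrite E rmorph_prod; apply: eq_bigr => z _ /=.
  rewrite map_polyZ/= rmorphB/= map_polyX map_polyC/=.
  by rewrite fmorphV rmorphB rmorph1.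
transitivity (map_poly toC q * map_poly toC q); first by rewrite expr2 rmorphM.
rewrite {1}E EJ -big_split/= [RHS]rmorph_prod big_map.
rewrite !(big_seq _ _ rs); apply: eq_bigr => z zrs.
by have [_ ->] := circle_pair (cyc _ (rootrs _ zrs)) (nz _ zrs).
Qed.

End root_factorization.

(** * Laws on the natural numbers *)

Section law_on_naturals.
Context {R : realType} d (T : measurableType d) (P : probability T R).
Variables (X : {RV P >-> R}) (n : nat).
Hypothesis hX : takes_values_upto X n.

Definition pmf_nat (k : nat) : R := fine (P [set t | X t = k%:R]).

Definition pgf_real : {poly R} := \poly_(k < n.+1) pmf_nat k.

Lemma pgfE : pgf X n = map_poly (real_complex R) pgf_real.
Proof.
apply/polyP => i; rewrite /pgf coef_map/= !coef_poly.
by case: ifP => // _; rewrite rmorph0.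
Qed.

Let D (k : nat) : set T := [set t | X t = k%:R].

Let mD k : measurable (D k).
Proof.
have -> : D k = X @^-1` [set k%:R] by [].
by rewrite -[X in measurable X]setTI; exact: measurable_funP.
Qed.

Let iD k : P.-integrable setT (EFin \o (\1_(D k) : T -> R)).
Proof.
apply: (@bounded_integrable_prob _ _ _ _ _ 1); first exact: measurable_indic.
by move=> x; rewrite indicE; case: (x \in D k); rewrite ?normr1 ?normr0.
Qed.

Let funE (f : R -> R) t : f (X t) = \sum_(k < n.+1) f k%:R * \1_(D k) t.
Proof.
have [k kn Xt] := hX t.
have kn' : (k < n.+1)%N by [].
rewrite (bigD1 (Ordinal kn'))//= big1 ?addr0.
  by rewrite indicE mem_set//= mulr1 Xt.
move=> i ik; rewrite indicE memNset ?mulr0//= /D/= Xt => /eqP.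
rewrite eqr_nat => /eqP kE; move/eqP: ik; apply; exact/val_inj.
Qed.

Let sum_integral (I : Type) (s : seq I) (F : I -> T -> R) :
  (forall i, P.-integrable setT (EFin \o F i)) ->
  P.-integrable setT (EFin \o (fun t => \sum_(i <- s) F i t)) /\
  \int[P]_t (\sum_(i <- s) F i t) = \sum_(i <- s) \int[P]_t F i t.
Proof.
move=> iF; elim: s => [|i s [IH1 IH2]].
  under eq_fun do rewrite big_nil.
  rewrite big_nil; split; last by rewrite Rintegral_cst// mul0r.
  by apply: (@bounded_integrable_prob _ _ _ _ _ 0) => // x; rewrite normr0.
under eq_fun do rewrite big_cons.
rewrite big_cons RintegralD// IH2; split=> //.
exact: (integrableD measurableT (iF i) IH1).
Qed.

(** f (X) is a finite combination of the indicators of the events X = k. *)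
Lemma integral_law (f : R -> R) :
  P.-integrable setT (EFin \o (fun t => f (X t))) /\
  \int[P]_t f (X t) = \sum_(k < n.+1) f k%:R * pmf_nat k.
Proof.
have iF (k : 'I_n.+1) : P.-integrable setT (EFin \o (fun t => f k%:R * \1_(D k) t)).
  exact: (integrableZl measurableT (f k%:R) (iD k)).
have [i1 i2] := sum_integral (index_enum 'I_n.+1) iF.
split; first by under eq_fun do rewrite funE.
under eq_Rintegral do rewrite funE.
rewrite i2; apply: eq_bigr => k _; rewrite RintegralZl//.
by rewrite /Rintegral integral_indic// setIT.
Qed.

Lemma pgf_real1 : pgf_real.[1] = 1.
Proof.
have [_] := integral_law (fun=> 1).
rewrite Rintegral_cst// mul1r => H.
rewrite /pgf_real horner_poly; apply: etrans (congr1 fine (probability_setT P)).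
by rewrite H; apply: eq_bigr => k _; rewrite expr1n mulr1 mul1r.
Qed.

Lemma fmoment_pgf_real j :
  fmoment pgf_real j = \sum_(k < n.+1) (k ^_ j)%:R * pmf_nat k.
Proof.
rewrite /fmoment /pgf_real poly_def linear_sum horner_sum.
apply: eq_bigr => k _.
by rewrite linearZ/= derivnXn hornerZ hornerMn hornerXn expr1n mulrC.
Qed.

Let ffact_natS (k j : nat) : (k ^_ j.+1)%:R = (k ^_ j)%:R * (k%:R - j%:R) :> R.
Proof.
rewrite ffactnSr natrM; have [jk|kj] := leqP j k; first by rewrite natrB.
by rewrite ffact_small// !mul0r.
Qed.

Let ffact_natE (k : nat) (x : R) : x = k%:R ->
  [/\ (k ^_ 1)%:R = x, (k ^_ 2)%:R = x * (x - 1), (k ^_ 3)%:R = x * (x - 1) * (x - 2) &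
      (k ^_ 4)%:R = x * (x - 1) * (x - 2) * (x - 3)].
Proof.
by move=> ->; rewrite !ffact_natS ffactn0 subr0 mul1r; split.
Qed.

Lemma meanE : mean X = mean_poly pgf_real.
Proof.
rewrite /mean expectation_def -/(Rintegral P setT X).
have [_] := integral_law id => /= ->.
rewrite /mean_poly fmoment_pgf_real; apply: eq_bigr => k _.
by rewrite ffactn1.
Qed.

Let expectE (f : R -> R) : fine 'E_P[(fun t => f (X t))%R] =
  \sum_(k < n.+1) f k%:R * pmf_nat k.
Proof. by rewrite unlock; have [_ <-] := integral_law f. Qed.

Let sum_pmf : \sum_(k < n.+1) pmf_nat k = 1.
Proof.
rewrite -pgf_real1 /pgf_real horner_poly; apply: eq_bigr => k _.
by rewrite expr1n mulr1.
Qed.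

Lemma second_momentE : \sum_(k < n.+1) (k%:R - mean X) ^+ 2 * pmf_nat k =
  variance_poly pgf_real.
Proof.
set m := mean X.
have mE : m = fmoment pgf_real 1 by rewrite /m meanE.
transitivity (fmoment pgf_real 2 + (1 - 2 * m) * fmoment pgf_real 1 + m ^+ 2 * 1).
  rewrite !fmoment_pgf_real -[in m ^+ 2 * 1]sum_pmf !mulr_sumr -!big_split/=.
  apply: eq_bigr => k _.
  by have [-> -> _ _] := ffact_natE (erefl (k%:R : R)); ring.
by rewrite /variance_poly -mE; ring.
Qed.

Lemma varianceE_poly : fine 'V_P[X] = variance_poly pgf_real.
Proof.
rewrite -second_momentE /variance unlock.
by rewrite -(expectE (fun x => (x - mean X) ^+ 2)); congr (fine _).
Qed.

Lemma stddev_gt0 : (0 < 'V_P[X])%E ->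
  0 < stddev X /\ stddev X ^+ 2 = variance_poly pgf_real.
Proof.
move=> V0; have Vfin : 'V_P[X] \is a fin_num.
  rewrite /variance unlock unlock.
  have [iv _] := integral_law (fun x => (x - mean X) ^+ 2).
  rewrite (_ : (\int[P]_w _)%E = (\int[P]_t ((X t - mean X) ^+ 2)%:E)%E).
    exact: (integrable_fin_num _ iv).
  by apply: eq_integral => t _; rewrite /mean expectation_def -expr2.
have V1 : 0 < fine 'V_P[X] by rewrite -lte_fin fineK.
by rewrite /stddev sqrtr_gt0 V1 sqr_sqrtr ?varianceE_poly// -varianceE_poly ltW.
Qed.

Lemma central_moment2E : central_moment X 2 = variance_poly pgf_real.
Proof.
by rewrite -second_momentE /central_moment (expectE (fun x => (x - mean X) ^+ 2)).
Qed.

Lemma central_moment4E : central_moment X 4 = fourth_moment_poly pgf_real.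
Proof.
rewrite /central_moment (expectE (fun x => (x - mean X) ^+ 4)).
set m := mean X.
have mE : m = fmoment pgf_real 1 by rewrite /m meanE.
transitivity (fmoment pgf_real 4 + (6 - 4 * m) * fmoment pgf_real 3
  + (7 - 12 * m + 6 * m ^+ 2) * fmoment pgf_real 2
  + (1 - 4 * m + 6 * m ^+ 2 - 4 * m ^+ 3) * fmoment pgf_real 1 + m ^+ 4 * 1).
  rewrite !fmoment_pgf_real -[in m ^+ 4 * 1]sum_pmf !mulr_sumr -!big_split/=.
  apply: eq_bigr => k _.
  by have [-> -> -> ->] := ffact_natE (erefl (k%:R : R)); ring.
by rewrite /fourth_moment_poly -mE mulr1.
Qed.

Lemma cumulant4E : cumulant4 X = cumulant4_poly pgf_real.
Proof. by rewrite /cumulant4 central_moment4E central_moment2E. Qed.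

Definition standardized (t : T) : R := (X t - mean X) / stddev X.

Lemma measurable_standardized : measurable_fun setT standardized.
Proof.
apply: measurable_funM => //; apply: measurable_funB => //.
Qed.

Lemma integrable_standardized : P.-integrable setT (EFin \o standardized).
Proof. by have [] := integral_law (fun x => (x - mean X) / stddev X). Qed.

End law_on_naturals.

Section characteristic_polynomial.
Context {R : realType}.
Local Open Scope complex_scope.

Definition cis (x : R) : R[i] := cos x +i* sin x.

Lemma cis0 : cis 0 = 1.
Proof. by rewrite /cis cos0 sin0. Qed.

Lemma cisD x y : cis (x + y) = cis x * cis y.
Proof.
apply/eqP; rewrite eq_complex/= cosD sinD; apply/andP; split=> //.
by rewrite addrC [sin x * _]mulrC.
Qed.

Lemma cisX x k : cis x ^+ k = cis (k%:R * x).
Proof.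
elim: k => [|k IH]; first by rewrite expr0 mul0r cis0.
by rewrite exprS IH -cisD -natr1 mulrDl mul1r addrC.
Qed.

Lemma normc_cis x : normc (cis x) = 1.
Proof. by rewrite /cis /normc cos2Dsin2 sqrtr1. Qed.

End characteristic_polynomial.

Section characteristic_function_of_law.
Context {R : realType} d (T : measurableType d) (P : probability T R).
Variables (X : {RV P >-> R}) (n : nat).
Hypothesis hX : takes_values_upto X n.
Local Open Scope complex_scope.

(** E e^{i tau (X - mean X)}; the generating function gives its product form. *)
Definition centered_char (tau : R) : R[i] :=
  cis (- (mean X * tau)) * (pgf X n).[cis tau].

Lemma centered_char_sum (tau : R) : centered_char tau =
  (\sum_(k < n.+1) cos ((k%:R - mean X) * tau) * pmf_nat X k) +i*
  (\sum_(k < n.+1) sin ((k%:R - mean X) * tau) * pmf_nat X k).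
Proof.
rewrite /centered_char /pgf horner_poly mulr_sumr.
have -> : \sum_(k < n.+1) cis (- (mean X * tau)) *
    ((fine (P [set t | X t = k%:R]))%:C * cis tau ^+ k) =
    \sum_(k < n.+1) ((cos ((k%:R - mean X) * tau) * pmf_nat X k) +i*
                     (sin ((k%:R - mean X) * tau) * pmf_nat X k)).
  apply: eq_bigr => k _; rewrite cisX mulrCA -cisD addrC -mulrBl /cis.
  apply/eqP; rewrite eq_complex/= !mul0r subr0 addr0.
  by rewrite -/(pmf_nat X k) ![pmf_nat X k * _]mulrC !eqxx.
elim/big_rec3: _ => [|k x y z _ ->]; first by rewrite complexr0.
by [].
Qed.

Lemma cos_transform_standardized t :
  cos_transform P (standardized X) t = complex.Re (centered_char (t / stddev X)).
Proof.
rewrite centered_char_sum /cos_transform /=.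
have [_ ->] := integral_law hX (fun x => cos (t * ((x - mean X) / stddev X))).
by apply: eq_bigr => k _; rewrite [in LHS]mulrCA.
Qed.

Lemma sin_transform_standardized t :
  sin_transform P (standardized X) t = complex.Im (centered_char (t / stddev X)).
Proof.
rewrite centered_char_sum /sin_transform /=.
have [_ ->] := integral_law hX (fun x => sin (t * ((x - mean X) / stddev X))).
by apply: eq_bigr => k _; rewrite [in LHS]mulrCA.
Qed.

End characteristic_function_of_law.

(** * Gaussian decay, products of complex factors, Bernoulli factors *)

Section gaussian_decay.
Context {R : realType}.
Implicit Types t : R.

Lemma gauss_decay t : expR (- (t ^+ 2 / 4)) <= 4 / (1 + t ^+ 2).
Proof.
rewrite expRN -[leRHS]invrK lef_pV2 ?posrE ?expR_gt0//; last first.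
  by rewrite invr_gt0 divr_gt0// ltr_pwDl// sqr_ge0.
apply: le_trans (expR_ge1Dx _); rewrite invf_div.
by have := sqr_ge0 t; lra.
Qed.

(** With y = t^2 / 4, this is 4 y (1 + 4 y) <= 32 (1 + y + y^2 / 2) <= 32 e^y. *)
Lemma gauss_decay3 t : 0 <= t ->
  t ^+ 3 * expR (- (t ^+ 2 / 4)) <= 32 * t / (1 + t ^+ 2).
Proof.
move=> t0; have t20 := sqr_ge0 t.
rewrite expRN ler_pdivlMr; last by rewrite ltr_pwDl.
rewrite mulrAC ler_pdivrMr ?expR_gt0//.
have y0 : 0 <= t ^+ 2 / 4 by rewrite divr_ge0.
apply: le_trans (_ : 32 * t * (1 + t ^+ 2 / 4 + (t ^+ 2 / 4) ^+ 2 / 2) <= _); last first.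
  by rewrite ler_wpM2l ?mulr_ge0//; exact: expR_ge_quadratic.
have -> : t ^+ 3 * (1 + t ^+ 2) = t * (t ^+ 2 * (1 + t ^+ 2)) by ring.
rewrite [32 * t]mulrC -[leRHS]mulrA ler_wpM2l//.
by move: (t ^+ 2) t20 => y; nra.
Qed.

Lemma expRN_sub_le (a b : R) : expR (- a) - expR (- b) <= (b - a) * expR (- a).
Proof.
have := expR_ge1Dx (a - b) => H.
have -> : expR (- b) = expR (a - b) * expR (- a) by rewrite -expRD; congr expR; ring.
have := expR_ge0 (- a); move: (expR (- a)) (expR (a - b)) H => x y; nra.
Qed.

Lemma cos_transform_normal t :
  cos_transform (@normal_prob R 0 1) id t = expR (- (t ^+ 2 / 2)).
Proof.
rewrite /cos_transform; under eq_Rintegral do rewrite -[_ * _]subr0.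
by rewrite Rintegral_normal_cos cos0 mul1r mulNr.
Qed.

Lemma sin_transform_normal t :
  sin_transform (@normal_prob R 0 1) id t = 0.
Proof.
rewrite /sin_transform; under eq_Rintegral do rewrite -cosBpihalf.
by rewrite Rintegral_normal_cos cos_pihalf mul0r.
Qed.

Lemma transform_decay_normal k : transform_decay (@normal_prob R 0 1) id 4 k.
Proof.
move=> t _; rewrite cos_transform_normal sin_transform_normal normr0; split.
  rewrite ger0_norm ?expR_ge0//; apply: le_trans (gauss_decay t).
  by rewrite ler_expR lerN2; have := sqr_ge0 t; lra.
by rewrite divr_ge0// addr_ge0// sqr_ge0.
Qed.

End gaussian_decay.

Section complex_modulus.
Context {R : realType}.
Local Open Scope complex_scope.
Implicit Types z w : R[i].

Lemma normc_ge0 z : 0 <= normc z.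
Proof. by case: z => a b; exact: sqrtr_ge0. Qed.

Lemma sqr_normc_ReIm z : normc z ^+ 2 = complex.Re z ^+ 2 + complex.Im z ^+ 2.
Proof. by case: z => a b /=; rewrite sqr_sqrtr// addr_ge0 ?sqr_ge0. Qed.

Lemma abs_Re_le z : `|complex.Re z| <= normc z.
Proof.
rewrite -ler_sqr ?nnegrE ?normc_ge0// real_normK ?num_real// sqr_normc_ReIm.
by rewrite lerDl sqr_ge0.
Qed.

Lemma abs_Im_le z : `|complex.Im z| <= normc z.
Proof.
rewrite -ler_sqr ?nnegrE ?normc_ge0// real_normK ?num_real// sqr_normc_ReIm.
by rewrite lerDr sqr_ge0.
Qed.

Lemma normc_le_ReIm z : normc z <= `|complex.Re z| + `|complex.Im z|.
Proof.
rewrite -ler_sqr ?nnegrE ?normc_ge0 ?addr_ge0// sqr_normc_ReIm sqrrD.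
rewrite !real_normK ?num_real// addrAC lerDl mulrn_wge0// mulr_ge0//.
Qed.

Lemma normc_real (x : R) : normc x%:C = `|x|.
Proof. by rewrite /= expr0n addr0 sqrtr_sqr. Qed.

(** Telescoping: exchanging the factors one at a time costs |f_i - g_i| times
    the remaining factors. The factor e^{s/4} compensates for the decay of the
    exchanged factor, as v_i <= 1/4. *)
Lemma normc_prod_sub_le (I : Type) (f g : I -> R[i]) (v : I -> R) (s delta : R)
    (l : seq I) : 0 <= s -> 0 <= delta ->
  (forall i, 0 <= v i <= 4^-1) ->
  (forall i, normc (f i) <= expR (- (s * v i))) ->
  (forall i, normc (g i) <= expR (- (s * v i))) ->
  (forall i, normc (f i - g i) <= delta * v i) ->
  normc (\prod_(i <- l) f i) <= expR (- (s * \sum_(i <- l) v i)) /\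
  normc (\prod_(i <- l) f i - \prod_(i <- l) g i) <=
    delta * (\sum_(i <- l) v i) * expR (s / 4) * expR (- (s * \sum_(i <- l) v i)).
Proof.
move=> s0 d0 v01 fv gv fg.
elim: l => [|i l [IH1 IH2]].
  by rewrite !big_nil subrr !mulr0 oppr0 expR0 !mul0r normc1 normc0.
have gl : normc (\prod_(j <- l) g j) <= expR (- (s * \sum_(j <- l) v j)).
  elim: l {IH1 IH2} => [|j l IH]; first by rewrite !big_nil mulr0 oppr0 expR0 normc1.
  by rewrite !big_cons normcM mulrDr opprD expRD ler_pM ?normc_ge0.
rewrite !big_cons; split.
  by rewrite normcM mulrDr opprD expRD ler_pM ?normc_ge0.
set F := \prod_(j <- l) f j in IH1 IH2 *; set G := \prod_(j <- l) g j in IH2 gl *.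
set V := \sum_(j <- l) v j in IH1 IH2 gl *.
have -> : f i * F - g i * G = f i * (F - G) + (f i - g i) * G by ring.
apply: le_trans (le_normcD _ _) _; rewrite !normcM.
have h1 : normc (f i) * normc (F - G) <=
    expR (- (s * v i)) * (delta * V * expR (s / 4) * expR (- (s * V))).
  by rewrite ler_pM ?normc_ge0.
have h2 : normc (f i - g i) * normc G <= (delta * v i) * expR (- (s * V)).
  by rewrite ler_pM ?normc_ge0.
apply: le_trans (lerD h1 h2) _.
have e1 : expR (- (s * (v i + V))) = expR (- (s * v i)) * expR (- (s * V)).
  by rewrite mulrDr opprD expRD.
have e2 : expR (- (s * V)) <= expR (s / 4) * expR (- (s * (v i + V))).
  rewrite -expRD ler_expR; have /andP[_ vi] := v01 i; nra.
have vi0 : 0 <= v i by have /andP[] := v01 i.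
have -> : delta * (v i + V) * expR (s / 4) * expR (- (s * (v i + V))) =
  expR (- (s * v i)) * (delta * V * expR (s / 4) * expR (- (s * V))) +
  delta * v i * (expR (s / 4) * expR (- (s * (v i + V)))).
  by rewrite e1; ring.
by rewrite lerD2l ler_wpM2l// mulr_ge0.
Qed.

End complex_modulus.

Section bernoulli_factor.
Context {R : realType}.
Local Open Scope complex_scope.
Variables (p tau : R).
Hypothesis p01 : 0 <= p <= 1.
Hypothesis tau1 : `|tau| <= 1.

Definition bernoulli_char : R[i] :=
  cis (- (p * tau)) * ((1 - p)%:C + p%:C * cis tau).

Let v := p * (1 - p).

Lemma bernoulli_charE : bernoulli_char =
  ((1 - p) * cos (p * tau) + p * cos ((1 - p) * tau)) +i*
  (p * sin ((1 - p) * tau) - (1 - p) * sin (p * tau)).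
Proof.
rewrite /bernoulli_char mulrDr mulrCA -cisD addrC.
have -> : - (p * tau) + tau = (1 - p) * tau by ring.
rewrite /cis cosN sinN; apply/eqP; rewrite eq_complex/=; apply/andP.
by split; apply/eqP; ring.
Qed.

(** The squared modulus is 1 - 2 p (1 - p) (1 - cos tau). *)
Lemma bernoulli_char_le : normc bernoulli_char <= expR (- (tau ^+ 2 / 4 * v)).
Proof.
have /andP[p0 p1] := p01.
rewrite /bernoulli_char normcM normc_cis mul1r.
rewrite -ler_sqr ?nnegrE ?normc_ge0 ?expR_ge0// sqr_normc_ReIm /=.
rewrite -expRM_natl.
apply: le_trans (expR_ge1Dx _).
have -> : (1 - p + (p * cos tau - 0 * sin tau)) ^+ 2 +
   (0 + (p * sin tau + 0 * cos tau)) ^+ 2 =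
   1 - 2 * v * (1 - cos tau) + p ^+ 2 * (cos tau ^+ 2 + sin tau ^+ 2 - 1).
  by rewrite /v; ring.
rewrite cos2Dsin2 subrr mulr0 addr0.
have := one_sub_cos_ge tau1.
have : 0 <= v by rewrite mulr_ge0 ?subr_ge0.
by move: v (cos tau) (tau ^+ 2 / 4) => v' c y; nra.
Qed.

(** Second-order Taylor expansion at 0: by centering, the terms of order 1
    cancel, and the terms of order 2 coincide. *)
Lemma bernoulli_char_gauss :
  normc (bernoulli_char - (expR (- (v * (tau ^+ 2 / 2))))%:C) <= `|tau| ^+ 3 * v.
Proof.
have /andP[p0 p1] := p01; have q0 : 0 <= 1 - p by rewrite subr_ge0.
have v0 : 0 <= v by rewrite mulr_ge0.
have v4 : v <= 4^-1 by rewrite /v; have := sqr_ge0 (p - 2^-1); nra.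
rewrite bernoulli_charE; apply: le_trans (normc_le_ReIm _) _ => /=.
rewrite subr0.
have t0 := normr_ge0 tau; set T := `|tau| in t0 *.
have T2 : tau ^+ 2 = T ^+ 2 by rewrite /T real_normK ?num_real.
have c1 := abs_cos_sub_le (p * tau); have c2 := abs_cos_sub_le ((1 - p) * tau).
have s1 := abs_sin_sub_le (p * tau); have s2 := abs_sin_sub_le ((1 - p) * tau).
have y0 : 0 <= v * (tau ^+ 2 / 2) by rewrite mulr_ge0// divr_ge0// sqr_ge0.
have e1 := expR_ge1Dx (- (v * (tau ^+ 2 / 2))); have e2 := expRN_le y0.
have T4 : tau ^+ 4 = T ^+ 4.
  have -> : tau ^+ 4 = (tau ^+ 2) ^+ 2 by ring.
  by rewrite T2; ring.
move: c1 c2; rewrite !exprMn T4 T2.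
move: s1 s2; rewrite !normrM -/T (ger0_norm p0) (ger0_norm q0) !exprMn.
move: e1 e2; rewrite T2.
have T43 : T ^+ 4 <= T ^+ 3 by rewrite exprS ler_piMl ?exprn_ge0.
have T30 : 0 <= T ^+ 3 by rewrite exprn_ge0.
move: (expR _) => e e1 e2.
rewrite !ler_norml => /andP[s1 s1'] /andP[s2 s2'] /andP[c1 c1'] /andP[c2 c2'].
have pq4 : p * (1 - p) ^+ 4 + (1 - p) * p ^+ 4 <= v.
  have -> : p * (1 - p) ^+ 4 + (1 - p) * p ^+ 4 = v * ((1 - p) ^+ 3 + p ^+ 3) by rewrite /v; ring.
  rewrite ler_piMr//; have -> : (1 - p) ^+ 3 + p ^+ 3 = 1 - 3 * v by rewrite /v; ring.
  by lra.
have pq3 : p * (1 - p) ^+ 3 + (1 - p) * p ^+ 3 <= v.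
  have -> : p * (1 - p) ^+ 3 + (1 - p) * p ^+ 3 = v * (1 - 2 * v) by rewrite /v; ring.
  by rewrite ler_piMr//; lra.
have ey : `|e - (1 - v * (T ^+ 2 / 2))| <= v * (T ^+ 3 / 8).
  have E : (v * (T ^+ 2 / 2)) ^+ 2 / 2 = v * (v * T ^+ 4 / 8) by field.
  have : v * T ^+ 4 / 8 <= T ^+ 3 / 8.
    rewrite ler_pM2r//; apply: le_trans T43.
    by rewrite ler_piMl ?exprn_ge0//; lra.
  move=> /(ler_wpM2l v0); rewrite -E => H.
  have : 0 <= v * (T ^+ 3 / 8) by rewrite mulr_ge0// divr_ge0.
  by rewrite ler_norml; lra.
set C1 := cos (p * tau) in c1 c1' *; set C2 := cos ((1 - p) * tau) in c2 c2' *.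
set S1 := sin (p * tau) in s1 s1' *; set S2 := sin ((1 - p) * tau) in s2 s2' *.
have reE : (1 - p) * C1 + p * C2 - e =
   (1 - p) * (C1 - (1 - p ^+ 2 * T ^+ 2 / 2)) +
   p * (C2 - (1 - (1 - p) ^+ 2 * T ^+ 2 / 2)) - (e - (1 - v * (T ^+ 2 / 2))).
  by rewrite /v; field.
have imE : p * S2 - (1 - p) * S1 =
   p * (S2 - (1 - p) * tau) - (1 - p) * (S1 - p * tau) by ring.
have re_le : `|(1 - p) * C1 + p * C2 - e| <= v * T ^+ 3 / 24 + v * (T ^+ 3 / 8).
  rewrite reE; apply: le_trans (ler_normB _ _) _; apply: lerD => //.
  apply: le_trans (_ : (1 - p) * (p ^+ 4 * T ^+ 4 / 24) + p * ((1 - p) ^+ 4 * T ^+ 4 / 24) <= _).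
    rewrite (le_trans (ler_normD _ _))// !normrM (ger0_norm p0) (ger0_norm q0).
    by apply: lerD; rewrite ler_wpM2l// ler_norml; apply/andP; split; lra.
  have -> : (1 - p) * (p ^+ 4 * T ^+ 4 / 24) + p * ((1 - p) ^+ 4 * T ^+ 4 / 24) =
    (p * (1 - p) ^+ 4 + (1 - p) * p ^+ 4) * T ^+ 4 / 24 by field.
  by rewrite ler_pM2r// ler_pM// ?exprn_ge0// addr_ge0// mulr_ge0// exprn_ge0.
have im_le : `|p * S2 - (1 - p) * S1| <= v * T ^+ 3 / 6.
  rewrite imE.
  apply: le_trans (_ : p * ((1 - p) ^+ 3 * T ^+ 3 / 6) + (1 - p) * (p ^+ 3 * T ^+ 3 / 6) <= _).
    rewrite (le_trans (ler_normB _ _))// !normrM (ger0_norm p0) (ger0_norm q0).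
    by apply: lerD; rewrite ler_wpM2l// ler_norml; apply/andP; split; lra.
  have -> : p * ((1 - p) ^+ 3 * T ^+ 3 / 6) + (1 - p) * (p ^+ 3 * T ^+ 3 / 6) =
    (p * (1 - p) ^+ 3 + (1 - p) * p ^+ 3) * T ^+ 3 / 6 by field.
  by rewrite ler_pM2r// ler_wpM2r.
apply: le_trans (lerD re_le im_le) _.
have : 0 <= T ^+ 3 * v by rewrite mulr_ge0.
have -> : v * T ^+ 3 / 24 + v * (T ^+ 3 / 8) + v * T ^+ 3 / 6 = T ^+ 3 * v / 3 by field.
by lra.
Qed.

End bernoulli_factor.

(** * Characteristic functions of real-rooted and of cyclotomic laws *)

Section real_rooted_case.
Context {R : realType} d (T : measurableType d) (P : probability T R).
Variables (X : {RV P >-> R}) (n : nat).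
Hypothesis hX : takes_values_upto X n.
Local Open Scope complex_scope.

Lemma centered_char_bernoulli (ps : seq R) (tau : R) :
  pgf_real X n = \prod_(p <- ps) bernoulli_poly p ->
  centered_char X n tau = \prod_(p <- ps) bernoulli_char p tau.
Proof.
move=> qE; rewrite /centered_char pgfE qE rmorph_prod horner_prod.
have -> : mean X = \sum_(p <- ps) p.
  rewrite (meanE hX) qE mean_poly_prod; last exact: bernoulli_poly1.
  by apply: eq_bigr => p _; rewrite mean_bernoulli_poly.
have -> : cis (- ((\sum_(p <- ps) p) * tau)) = \prod_(p <- ps) cis (- (p * tau)).
  rewrite mulr_suml -sumrN.
  by elim/big_rec2: _ => [|p y z _ <-]; rewrite ?cis0 ?cisD.
rewrite -big_split/=; apply: eq_bigr => p _; rewrite /bernoulli_char.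
by rewrite map_bernoulli_poly hornerD hornerC hornerZ hornerX.
Qed.

(** Here the telescoping bound is used with tau = t / sigma, s = tau^2 / 4 and
    delta = tau^3, for which tau^3 sigma^2 = t^3 / sigma. *)
Lemma real_rooted_char_bound (t : R) : (0 < 'V_P[X])%E ->
  real_rooted (pgf X n) -> 0 < t <= stddev X ->
  normc (centered_char X n (t / stddev X)) <= expR (- (t ^+ 2 / 4)) /\
  normc (centered_char X n (t / stddev X) - (expR (- (t ^+ 2 / 2)))%:C) <=
    2 / stddev X * (t ^+ 3 * expR (- (t ^+ 2 / 4))).
Proof.
move=> V0; rewrite pgfE => rr /andP[t0 ts].
have [s0 s2] := stddev_gt0 hX V0.
have [ps ps01 qE] := real_rooted_factorization (pgf_real1 hX) rr.
set tau := t / stddev X; rewrite (centered_char_bernoulli tau qE).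
have tau0 : 0 <= tau by rewrite divr_ge0// ltW.
have tau1 : `|tau| <= 1 by rewrite ger0_norm// ler_pdivrMr// mul1r.
(* The factors are extended to all p, outside of [0, 1] by trivial ones, because
   the telescoping bound asks for hypotheses on every index. *)
pose v (p : R) : R := if 0 <= p <= 1 then p * (1 - p) else 0.
pose g (p : R) : R[i] := (expR (- (v p * (tau ^+ 2 / 2))))%:C.
pose f (p : R) : R[i] := if 0 <= p <= 1 then bernoulli_char p tau else g p.
have vps : \sum_(p <- ps) v p = stddev X ^+ 2.
  rewrite s2 qE variance_poly_prod; last exact: bernoulli_poly1.
  rewrite !big_seq; apply: eq_bigr => p /ps01 p01.
  by rewrite variance_bernoulli_poly /v p01.
have fps : \prod_(p <- ps) bernoulli_char p tau = \prod_(p <- ps) f p.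
  by rewrite !big_seq; apply: eq_bigr => p /ps01 p01; rewrite /f p01.
have gps : \prod_(p <- ps) g p = (expR (- (t ^+ 2 / 2)))%:C.
  rewrite /g -rmorph_prod -expR_sum sumrN -mulr_suml vps.
  congr (expR (- _))%:C; rewrite /tau; field; exact: lt0r_neq0.
have t20 : 0 <= tau ^+ 2 by exact: sqr_ge0.
have v01 p : 0 <= v p <= 4^-1.
  rewrite /v; case: ifP => [/andP[p0 p1]|_]; last by apply/andP; split; lra.
  by apply/andP; split; have := sqr_ge0 (p - 2^-1); nra.
have gv p : normc (g p) <= expR (- (tau ^+ 2 / 4 * v p)).
  rewrite normc_real ger0_norm ?expR_ge0// ler_expR lerN2.
  by have /andP[v0 _] := v01 p; nra.
have fv p : normc (f p) <= expR (- (tau ^+ 2 / 4 * v p)).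
  rewrite /f; case: ifP => p01; last exact: gv.
  by rewrite /v p01; exact: bernoulli_char_le.
have fg p : normc (f p - g p) <= `|tau| ^+ 3 * v p.
  rewrite /f; case: ifP => p01; last first.
    by rewrite subrr normc0 mulr_ge0 ?exprn_ge0//; have /andP[] := v01 p.
  by rewrite /g /v p01; exact: bernoulli_char_gauss.
have s40 : 0 <= tau ^+ 2 / 4 by rewrite divr_ge0.
have [H1 H2] := normc_prod_sub_le ps s40 (exprn_ge0 3 (normr_ge0 tau)) v01 fv gv fg.
rewrite -fps gps vps in H1 H2.
have tE : tau ^+ 2 / 4 * stddev X ^+ 2 = t ^+ 2 / 4.
  by rewrite /tau; field; exact: lt0r_neq0.
rewrite tE in H1 H2; split=> //; apply: le_trans H2 _.
(* the factor e^{s/4}, with s = tau^2 / 4 <= 1/4 *)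
have e2 : expR (tau ^+ 2 / 4 / 4) <= 2.
  have tau2 : tau ^+ 2 <= 1 by rewrite -(expr1n _ 2) -(ger0_norm tau0) ler_sqr ?nnegrE.
  rewrite -[X in expR X]opprK expRN -[leRHS]invrK lef_pV2 ?posrE ?expR_gt0 ?invr_gt0//.
  by apply: le_trans (expR_ge1Dx _); lra.
rewrite ger0_norm//.
have -> : tau ^+ 3 * stddev X ^+ 2 = t ^+ 3 / stddev X.
  by rewrite /tau; field; exact: lt0r_neq0.
have -> : 2 / stddev X * (t ^+ 3 * expR (- (t ^+ 2 / 4))) =
  t ^+ 3 / stddev X * 2 * expR (- (t ^+ 2 / 4)) by ring.
rewrite ler_wpM2r ?expR_ge0// ler_wpM2l// divr_ge0// ?exprn_ge0// ltW//.
Qed.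

End real_rooted_case.

Section cyclotomic_case.
Context {R : realType} d (T : measurableType d) (P : probability T R).
Variables (X : {RV P >-> R}) (n : nat).
Hypothesis hX : takes_values_upto X n.
Local Open Scope complex_scope.

Section factorized.
Variable s : seq R.
Hypothesis s_ge : forall a, a \in s -> 2^-1 <= a.
Hypothesis qE : pgf_real X n ^+ 2 = \prod_(a <- s) circle_poly a.

Let q1 : (pgf_real X n).[1] = 1 := pgf_real1 hX.

Let var_s : 2 * variance_poly (pgf_real X n) = \sum_(a <- s) a.
Proof.
have : variance_poly (pgf_real X n ^+ 2) = \sum_(a <- s) a.
  rewrite qE variance_poly_prod; last exact: circle_poly1.
  by apply: eq_bigr => a _; rewrite variance_circle_poly.
by rewrite expr2 variance_polyM// => <-; ring.
Qed.

Let cum_s : 2 * cumulant4 X = \sum_(a <- s) (a - 3 * a ^+ 2).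
Proof.
have : cumulant4_poly (pgf_real X n ^+ 2) = \sum_(a <- s) (a - 3 * a ^+ 2).
  rewrite qE cumulant4_poly_prod; last exact: circle_poly1.
  by apply: eq_bigr => a _; rewrite cumulant4_circle_poly.
by rewrite expr2 cumulant4_polyM// (cumulant4E hX) => <-; ring.
Qed.

Let mean_s : 2 * mean X = (size s)%:R.
Proof.
have : mean_poly (pgf_real X n ^+ 2) = (size s)%:R.
  rewrite qE mean_poly_prod; last exact: circle_poly1.
  under eq_bigr do rewrite mean_circle_poly.
  by rewrite big_const_seq count_predT iter_addr_0.
by rewrite expr2 mean_polyM// (meanE hX) => <-; ring.
Qed.

(** (e^{i tau} - 1)^2 = e^{i tau} (2 cos tau - 2). *)
Lemma circle_poly_cis (a tau : R) :
  (map_poly (real_complex R) (circle_poly a)).[cis tau] =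
  cis tau * (1 - a * (1 - cos tau))%:C.
Proof.
rewrite map_circle_poly expr2 hornerD hornerX hornerZ hornerM hornerXsubC.
apply/eqP; rewrite eq_complex/=; have cs := cos2Dsin2 tau.
have s2 : sin tau ^+ 2 = 1 - cos tau ^+ 2 by rewrite -cs; ring.
apply/andP; split; apply/eqP.
  rewrite !(mul0r, mulr0, subr0, addr0, add0r, oppr0).
  have -> : (cos tau - 1) * (cos tau - 1) - sin tau * sin tau =
    (cos tau - 1) ^+ 2 - sin tau ^+ 2 by ring.
  by rewrite s2; field.
by rewrite !(mul0r, mulr0, subr0, addr0, add0r, oppr0); field.
Qed.

(** Each of the factors contributes one e^{i tau}; they are cancelled by the
    centering, since every factor has mean 1 and so twice the mean of X is the
    number of factors. *)
Lemma sqr_centered_char (tau : R) :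
  centered_char X n tau ^+ 2 = (\prod_(a <- s) (1 - a * (1 - cos tau)))%:C.
Proof.
rewrite /centered_char pgfE exprMn cisX.
have -> : 2%:R * - (mean X * tau) = - ((size s)%:R * tau).
  by rewrite -mean_s; ring.
have -> : (map_poly (real_complex R) (pgf_real X n)).[cis tau] ^+ 2 =
    cis ((size s)%:R * tau) * (\prod_(a <- s) (1 - a * (1 - cos tau)))%:C.
  rewrite -horner_exp -rmorphXn qE rmorph_prod horner_prod.
  under eq_bigr do rewrite circle_poly_cis.
  rewrite big_split/= rmorph_prod; congr (_ * _).
  by rewrite big_const_seq count_predT iter_mulr_1 cisX.
by rewrite mulrA -cisD addNr cis0 mul1r.
Qed.

Hypothesis V0 : (0 < 'V_P[X])%E.
Let sigma := stddev X.
Let K := `|cumulant4 X|.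
Let Q := \sum_(a <- s) a ^+ 2.

Lemma square_root_of_real (z : R[i]) (r : R) : 0 < r -> z ^+ 2 = r%:C ->
  complex.Im z = 0 /\ complex.Re z ^+ 2 = r.
Proof.
case: z => x y r0 /eqP; rewrite expr2 eq_complex/= => /andP[/eqP re /eqP im].
have xy : x * y = 0 by lra.
have y0 : y = 0.
  have [//|yn0] := eqVneq y 0; exfalso.
  have x0 : x = 0 by apply/eqP; move/eqP: xy; rewrite mulf_eq0 (negbTE yn0) orbF.
  by move: re; rewrite x0; have := sqr_ge0 y; nra.
by rewrite y0 expr2; split => //; rewrite -re y0 mulr0 subr0.
Qed.

Let sigma0 : 0 < sigma. Proof. by have [] := stddev_gt0 hX V0. Qed.

Let sum_s : \sum_(a <- s) a = 2 * sigma ^+ 2.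
Proof. by rewrite -var_s; have [_ ->] := stddev_gt0 hX V0. Qed.

Let Q_le : Q <= 2 * K.
Proof.
have : - (2 * cumulant4 X) = \sum_(a <- s) (3 * a ^+ 2 - a).
  by rewrite cum_s -sumrN; apply: eq_bigr => a _; ring.
have : Q <= \sum_(a <- s) (3 * a ^+ 2 - a).
  rewrite /Q !big_seq; apply: ler_sum => a /s_ge a2; nra.
move=> H E; apply: le_trans H _; rewrite -E /K.
have := ler_norm (- cumulant4 X); rewrite normrN; lra.
Qed.

Let sigma_le : sigma ^+ 2 <= Q.
Proof.
have : \sum_(a <- s) a <= \sum_(a <- s) (2 * a ^+ 2).
  rewrite !big_seq; apply: ler_sum => a /s_ge a2; nra.
by rewrite sum_s -mulr_sumr -/Q; lra.
Qed.

Let sqr_le a : a \in s -> a ^+ 2 <= Q.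
Proof.
move=> sa; rewrite /Q (big_rem a)//= lerDl sumr_ge0// => b _; exact: sqr_ge0.
Qed.

(** A positive variance provides at least one factor, for which a^2 >= 1/4. *)
Lemma cyclotomic_cumulant4_ge : 8^-1 <= K.
Proof.
have [a sa] : exists a, a \in s.
  have := sum_s; case: (s) => [|a l _]; last by exists a; rewrite mem_head.
  by rewrite big_nil => /esym/eqP; rewrite mulf_eq0 pnatr_eq0/= sqrf_eq0 gt_eqF.
have := sqr_le sa; have := s_ge sa; have := Q_le; nra.
Qed.

Let L := K `^ 4^-1.

Let L4 : L ^+ 4 = K.
Proof.
rewrite /L -powR_mulrn ?powR_ge0// -powRrM mulVf// powRr1// normr_ge0//.
Qed.

Let L0 : 0 < L.
Proof. by rewrite powR_gt0//; apply: lt_le_trans cyclotomic_cumulant4_ge; rewrite invr_gt0. Qed.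

Let L_ge : 1 <= 2 * L.
Proof.
rewrite leNgt; apply/negP => L2; have := cyclotomic_cumulant4_ge; rewrite -L4.
have L22 : L ^+ 2 < 4^-1 by have := L0; nra.
have -> : L ^+ 4 = (L ^+ 2) ^+ 2 by ring.
by have := sqr_ge0 L; nra.
Qed.

Let a_le a : a \in s -> a <= 3 / 2 * L ^+ 2.
Proof.
move=> sa; have := sqr_le sa; have := Q_le; rewrite -L4.
have := s_ge sa; have -> : L ^+ 4 = (L ^+ 2) ^+ 2 by ring.
have : 0 < L ^+ 2 by rewrite exprn_gt0.
by move: (L ^+ 2) => l; nra.
Qed.

Section range.
Variable t : R.
Hypothesis t_range : 0 <= t <= sigma / (2 * L).

Let tau := t / sigma.

Let tau_ge0 : 0 <= tau.
Proof. by rewrite divr_ge0 ?(ltW sigma0)//; case/andP: t_range. Qed.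

Let tauL : tau * L <= 2^-1.
Proof.
rewrite /tau mulrAC ler_pdivrMr// mulrC -ler_pdivlMl//.
have /andP[_] := t_range; congr (_ <= _).
by rewrite invfM; field; exact: lt0r_neq0.
Qed.

Let tau1 : `|tau| <= 1.
Proof. by rewrite ger0_norm//; have := tauL; have := L_ge; have := tau_ge0; nra. Qed.

Let u := 1 - cos tau.

Let u_bounds : tau ^+ 2 / 4 <= u <= tau ^+ 2 / 2.
Proof.
rewrite one_sub_cos_ge//=; have := cos_ge tau; rewrite /u; lra.
Qed.

Let u_ge : tau ^+ 2 / 2 - tau ^+ 4 / 24 <= u.
Proof. by have := cos_le tau; rewrite /u; lra. Qed.

Let au a : a \in s -> 0 <= a * u <= 2^-1.
Proof.
move=> sa; have := a_le sa; have := s_ge sa; have /andP[u1 u2] := u_bounds.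
have t2 := sqr_ge0 tau.
have tl : (tau * L) ^+ 2 <= 4^-1.
  have y0 : 0 <= tau * L by rewrite mulr_ge0// ltW.
  by have := tauL; move: (tau * L) y0 => y; nra.
move: tl; rewrite exprMn => tl a0 a1; apply/andP; split; first by nra.
apply: le_trans (_ : 3 / 2 * L ^+ 2 * (tau ^+ 2 / 2) <= _).
  by rewrite ler_pM//; lra.
by move: (L ^+ 2) (tau ^+ 2) tl t2 => l2 tt; lra.
Qed.

Let r := \prod_(a <- s) (1 - a * u).

Let r_gt0 : 0 < r.
Proof.
rewrite /r big_seq; apply: prodr_gt0 => a /au; lra.
Qed.

Let r_le : r <= expR (- (2 * (sigma ^+ 2 * u))).
Proof.
have -> : 2 * (sigma ^+ 2 * u) = \sum_(a <- s) a * u.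
  by rewrite -mulr_suml sum_s mulrA.
rewrite -sumrN expR_sum /r !big_seq; apply: ler_prod => a /au /andP[a1 a2].
apply/andP; split; first by lra.
exact: expR_ge1Dx.
Qed.

Let r_ge : expR (- (2 * (sigma ^+ 2 * u) + u ^+ 2 * Q)) <= r.
Proof.
have -> : 2 * (sigma ^+ 2 * u) + u ^+ 2 * Q = \sum_(a <- s) (a * u + (a * u) ^+ 2).
  rewrite big_split/= -mulr_suml sum_s mulrA; congr (_ + _).
  by rewrite /Q mulr_sumr; apply: eq_bigr => a _; ring.
rewrite -sumrN expR_sum /r !big_seq; apply: ler_prod => a /au /andP[a1 a2].
rewrite expR_ge0/=; apply: expRN_le_1B; exact/andP.
Qed.

Lemma cyclotomic_char_sqr : complex.Im (centered_char X n tau) = 0 /\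
  complex.Re (centered_char X n tau) ^+ 2 = r.
Proof. by apply: square_root_of_real r_gt0 _; rewrite sqr_centered_char. Qed.

Lemma cyclotomic_char_neq0 : complex.Re (centered_char X n tau) != 0.
Proof.
have [_ re] := cyclotomic_char_sqr; apply/eqP => H; move: r_gt0.
by rewrite -re H expr0n ltxx.
Qed.

(** The inequalities e^{-x-x^2} <= 1 - x <= e^{-x}, applied to every factor of
    phi^2, give e^{-Lambda_1} <= phi <= e^{-Lambda_0} with
    Lambda_0 = sigma^2 u and Lambda_1 = sigma^2 u + u^2 Q / 2, where
    u = 1 - cos tau is close to tau^2 / 2. Both exponents are close to
    t^2 / 2 = sigma^2 tau^2 / 2, up to |kappa| tau^4 / 4 as
    sigma^2 <= Q <= 2 |kappa|. *)
Lemma cyclotomic_char_gt0_bound :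
  0 < complex.Re (centered_char X n tau) ->
  complex.Re (centered_char X n tau) <= expR (- (t ^+ 2 / 4)) /\
  `|complex.Re (centered_char X n tau) - expR (- (t ^+ 2 / 2))| <=
    K / 4 * tau ^+ 4 * expR (- (t ^+ 2 / 4)).
Proof.
have [_] := cyclotomic_char_sqr; set x := complex.Re _ => xr x0.
have /andP[u1 u2] := u_bounds.
have s20 : 0 <= sigma ^+ 2 by exact: sqr_ge0.
have t2 : t ^+ 2 = sigma ^+ 2 * tau ^+ 2.
  by rewrite /tau; field; exact: lt0r_neq0.
have u0 : 0 <= u by apply: le_trans u1; rewrite divr_ge0// sqr_ge0.
have Q0 : 0 <= Q by apply: sumr_ge0 => a _; exact: sqr_ge0.
have x_le : x <= expR (- (sigma ^+ 2 * u)).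
  rewrite -ler_sqr ?nnegrE ?expR_ge0 ?(ltW x0)// xr -expRM_natl.
  by rewrite mulrN; exact: r_le.
have x_ge : expR (- (sigma ^+ 2 * u + u ^+ 2 * Q / 2)) <= x.
  rewrite -ler_sqr ?nnegrE ?expR_ge0 ?(ltW x0)// xr -expRM_natl.
  apply: le_trans r_ge; rewrite le_eqVlt; apply/orP; left; apply/eqP.
  by congr expR; field.
have l0 : t ^+ 2 / 4 <= sigma ^+ 2 * u.
  by rewrite t2 -mulrA ler_wpM2l.
have l1 : sigma ^+ 2 * u <= t ^+ 2 / 2.
  by rewrite t2 -mulrA ler_wpM2l.
have tau4 : 0 <= tau ^+ 4 by rewrite exprn_ge0.
have e0 : expR (- (sigma ^+ 2 * u)) <= expR (- (t ^+ 2 / 4)) by rewrite ler_expR lerN2.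
have e1 : expR (- (t ^+ 2 / 2)) <= expR (- (t ^+ 2 / 4)).
  by rewrite ler_expR lerN2; have := sqr_ge0 t; lra.
have g0 := expR_ge0 (- (t ^+ 2 / 4)).
split; first exact: le_trans x_le e0.
have up : x - expR (- (t ^+ 2 / 2)) <= K / 4 * tau ^+ 4 * expR (- (t ^+ 2 / 4)).
  apply: le_trans (_ : (t ^+ 2 / 2 - sigma ^+ 2 * u) * expR (- (sigma ^+ 2 * u)) <= _).
    by apply: le_trans (expRN_sub_le _ _); rewrite lerD2r.
  apply: ler_pM => //; first by rewrite subr_ge0.
  have h1 : t ^+ 2 / 2 - sigma ^+ 2 * u <= sigma ^+ 2 * (tau ^+ 4 / 24).
    by rewrite t2; have := ler_wpM2l s20 u_ge; lra.
  apply: le_trans h1 _.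
  have := le_trans sigma_le Q_le => sK.
  have K0 : 0 <= K * tau ^+ 4 by rewrite mulr_ge0// normr_ge0.
  by have := ler_wpM2r tau4 sK; lra.
have down : expR (- (t ^+ 2 / 2)) - x <= K / 4 * tau ^+ 4 * expR (- (t ^+ 2 / 4)).
  set L1 := sigma ^+ 2 * u + u ^+ 2 * Q / 2 in x_ge.
  apply: le_trans (_ : (L1 - t ^+ 2 / 2) * expR (- (t ^+ 2 / 2)) <= _).
    by apply: le_trans (expRN_sub_le _ _); rewrite lerD2l lerN2.
  have u2Q : u ^+ 2 * Q / 2 <= K / 4 * tau ^+ 4.
    have uu : u ^+ 2 <= tau ^+ 4 / 4.
      have -> : tau ^+ 4 / 4 = (tau ^+ 2 / 2) ^+ 2 by field.
      by rewrite ler_sqr ?nnegrE// divr_ge0// sqr_ge0.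
    have := ler_pM (sqr_ge0 u) Q0 uu Q_le; lra.
  apply: le_trans (_ : K / 4 * tau ^+ 4 * expR (- (t ^+ 2 / 2)) <= _).
    by rewrite ler_wpM2r ?expR_ge0// /L1; lra.
  by rewrite ler_wpM2l// mulr_ge0// divr_ge0// normr_ge0.
rewrite ler_norml; apply/andP; split; lra.
Qed.

End range.

(** Intermediate values: the characteristic function is real and continuous, is 1
    at 0, and does not vanish on the range, since its square is positive. *)
Lemma cyclotomic_char_gt0 (t : R) : 0 <= t <= sigma / (2 * L) ->
  0 < complex.Re (centered_char X n (t / sigma)).
Proof.
move=> /andP[t0 tm]; rewrite ltNge; apply/negP => le0.
pose f (w : R) := cos_transform P (standardized X) w.
have fE w : f w = complex.Re (centered_char X n (w / sigma)).
  exact: cos_transform_standardized.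
have cf : continuous f.
  rewrite (_ : f = fun w => \int[P]_x cos (w * standardized X x - 0)).
    exact/continuous_cos_transform/measurable_standardized.
  by apply/funext => w; apply: eq_Rintegral => x _; rewrite subr0.
have f0 : f 0 = 1.
  rewrite /f /cos_transform; under eq_Rintegral do rewrite mul0r cos0.
  by rewrite Rintegral_cst// mul1r; exact: (congr1 fine (probability_setT P)).
have [||w] := @IVT R f 0 t 0 t0.
- exact: continuous_subspaceT.
- by rewrite f0 ge_min le_max fE le0 ler01 orbT.
rewrite in_itv/= => /andP[w0 wt] fw.
have wr : 0 <= w <= sigma / (2 * L) by rewrite w0 (le_trans wt).
by have := cyclotomic_char_neq0 wr; rewrite -fE fw eqxx.
Qed.

(** |kappa| tau^4 = (L tau)^4, where L tau = L t / sigma <= 1/2. *)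
Lemma cyclotomic_char_bound (t : R) : 0 < t <= sigma / (2 * L) ->
  [/\ complex.Im (centered_char X n (t / sigma)) = 0,
    `|complex.Re (centered_char X n (t / sigma))| <= expR (- (t ^+ 2 / 4)) &
    `|complex.Re (centered_char X n (t / sigma)) - expR (- (t ^+ 2 / 2))| <=
      L / (32 * sigma) * (t * expR (- (t ^+ 2 / 4)))].
Proof.
move=> /andP[t0 tm]; have tr : 0 <= t <= sigma / (2 * L) by rewrite ltW.
have phi0 := cyclotomic_char_gt0 tr.
have [im _] := cyclotomic_char_sqr tr.
have [h1 h2] := cyclotomic_char_gt0_bound tr phi0.
split=> //; first by rewrite ger0_norm// ltW.
apply: le_trans h2 _.
rewrite mulrA ler_wpM2r ?expR_ge0// -L4.
set tau := t / sigma.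
have tau0 : 0 <= tau by rewrite divr_ge0// ltW.
have tauL : tau * L <= 2^-1.
  rewrite /tau mulrAC ler_pdivrMr// mulrC -ler_pdivlMl//.
  by move: tm; congr (_ <= _); rewrite invfM; field; exact: lt0r_neq0.
have -> : L / (32 * sigma) * t = (tau * L) / 32.
  by rewrite /tau; field; exact: lt0r_neq0.
have -> : L ^+ 4 / 4 * tau ^+ 4 = (tau * L) * ((tau * L) ^+ 3 / 4) by field.
have y0 : 0 <= tau * L by rewrite mulr_ge0// ltW.
rewrite ler_wpM2l//.
have : (tau * L) ^+ 3 <= (2^-1) ^+ 3 by rewrite lerXn2r ?nnegrE.
have -> : (2^-1) ^+ 3 = 8^-1 :> R by field.
lra.
Qed.

End factorized.

End cyclotomic_case.

(** * Normal approximation *)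

Section normal_approximation.
Context {R : realType}.

(** The normal law decays fast enough for the decay hypothesis to concern X
    only; e^{-t^2/4} <= 4 / (1 + t^2) is where A = 4 comes from. *)
Lemma normal_distance_bound : exists2 K : R, 0 < K &
  forall (n : nat) (d : measure_display) (T : measurableType d)
    (P : probability T R) (X : {RV P >-> R}) (k B : R),
  takes_values_upto X n -> 0 < k ->
  (forall t, 0 < t <= k ->
    [/\ `|cos_transform P (standardized X) t| <= expR (- (t ^+ 2 / 4)),
        `|sin_transform P (standardized X) t| <= expR (- (t ^+ 2 / 4)),
        `|cos_transform P (standardized X) t - expR (- (t ^+ 2 / 2))|
          <= B * t / (1 + t ^+ 2) &
        `|sin_transform P (standardized X) t| <= B * t / (1 + t ^+ 2)]) ->
  (normal_distance X <= (K * (4 / k + B))%:E)%E.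
Proof.
have [K K0 HK] := @smoothing_inequality R.
exists K => // n d T P X k B hX k0 H.
have mY := measurable_standardized X; have iY := integrable_standardized hX.
apply: ge_ereal_sup => _ [w _ <-]; rewrite lee_fin -normal_cdfE.
apply: (HK _ _ _ _ _ _ (@normal_prob R 0 1) id 4 B k mY iY _ integrable_normal_id k0) => //.
- by move=> t /H[h1 h2 _ _]; split; apply: le_trans (gauss_decay t).
- exact: transform_decay_normal.
- move=> t /H[_ _ h1 h2].
  by rewrite cos_transform_normal sin_transform_normal subr0.
Qed.

End normal_approximation.

Theorem theorem1 (R : realType) :
  exists c1 c2 : R, [/\ 0 < c1, 0 < c2 &
    forall (n : nat) (d : measure_display) (T : measurableType d)
      (P : probability T R) (X : {RV P >-> R}),
      takes_values_upto X n ->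
      (0 < 'V_P[X])%E ->
      (real_rooted (pgf X n) ->
        (normal_distance X <= (c1 / stddev X)%:E)%E) /\
      (cyclotomic (pgf X n) ->
        (normal_distance X <=
          (c2 * (`|cumulant4 X| `^ 4^-1 / stddev X))%:E)%E)].
Proof.
have [K K0 HK] := @normal_distance_bound R.
(* 68 = 4 + 64 with k = sigma and B = 64 / sigma; 9 = 8 + 1 with
   k = sigma / (2 L) and B = L / sigma. *)
exists (68 * K), (9 * K); split; [by rewrite mulr_gt0|by rewrite mulr_gt0|].
move=> n d T P X hX V0; have [s0 s2] := stddev_gt0 hX V0; split.
- move=> rr.
  have -> : 68 * K / stddev X = K * (4 / stddev X + 64 / stddev X) by ring.
  apply: (HK n) => // t /[dup] tk /andP[t0 _].
  rewrite (cos_transform_standardized hX) (sin_transform_standardized hX).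
  have [h1 h2] := real_rooted_char_bound hX V0 rr tk.
  have h3 : 2 / stddev X * (t ^+ 3 * expR (- (t ^+ 2 / 4))) <=
      64 / stddev X * t / (1 + t ^+ 2).
    have -> : 64 / stddev X * t / (1 + t ^+ 2) =
      2 / stddev X * (32 * t / (1 + t ^+ 2)) by ring.
    by rewrite ler_wpM2l ?gauss_decay3 ?divr_ge0 ?ltW.
  have h4 := le_trans h2 h3.
  have := abs_Re_le (centered_char X n (t / stddev X)).
  have := abs_Im_le (centered_char X n (t / stddev X)).
  have := le_trans (abs_Re_le _) h4; have := le_trans (abs_Im_le _) h4.
  case: (centered_char _ _ _) h1 {h2 h4} => x y h1 /=.
  rewrite oppr0 addr0 => a1 a2 a3 a4.
  by split => //; exact: le_trans h1.
- rewrite pgfE => cyc.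
  have [s s_ge qE] := cyclotomic_factorization (pgf_real1 hX) cyc.
  set L := _ `^ _.
  have bound := cyclotomic_char_bound hX s_ge qE V0.
  have L0 : 0 < L.
    rewrite powR_gt0//; apply: lt_le_trans (cyclotomic_cumulant4_ge hX s_ge qE V0).
    by rewrite invr_gt0.
  have -> : 9 * K * (L / stddev X) =
    K * (4 / (stddev X / (2 * L)) + L / stddev X).
    by field; rewrite !gt_eqF.
  apply: (HK n) => //; first by rewrite divr_gt0// mulr_gt0.
  move=> t /[dup] tk /andP[t0 _].
  rewrite (cos_transform_standardized hX) (sin_transform_standardized hX).
  have [-> h1 h2] := bound t tk.
  have Bt0 : 0 <= L / stddev X * t / (1 + t ^+ 2).
    rewrite divr_ge0//; last by rewrite addr_ge0// sqr_ge0.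
    by rewrite mulr_ge0 ?(ltW t0)// divr_ge0 ?(ltW L0) ?(ltW s0).
  rewrite normr0; split=> //.
  apply: le_trans h2 _.
  apply: le_trans (_ : L / (32 * stddev X) * (t * (4 / (1 + t ^+ 2))) <= _).
    rewrite ler_wpM2l//; first by rewrite divr_ge0 ?(ltW L0)// mulr_ge0// ltW.
    by rewrite ler_wpM2l ?(ltW t0)// gauss_decay.
  have -> : L / (32 * stddev X) * (t * (4 / (1 + t ^+ 2))) =
    L / stddev X * t / (1 + t ^+ 2) / 8.
    by field; rewrite ?gt_eqF// ltr_pwDl// sqr_ge0.
  lra.
Qed.
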